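(* Let $\{s_n\}_{n=0}^\infty$ be a summable sequence of non-negative numbers, not all zero, and let $\alpha\in\mathbb{R}_+$. Then $$S:=\sum_{n=0}^\infty s_n\,\mathcal{L}_n^{(\alpha)}\otimes\mathcal{L}_n^{(\alpha)}$$ is an admissible operator on $L^2(\mathbb{R}_+)$ with $$\mathrm{tr}(\mathcal{D}^{-1}S\mathcal{D}^{-1})=\frac1\alpha\sum_{n=0}^\infty s_n.$$
   Context: $\mathbb{R}_+=(0,\infty)$ and $L^2(\mathbb{R}_+)=L^2(\mathbb{R}_+,r^{-1}dr)$; $(\psi\otimes\phi)(\xi)=\langle\xi,\phi\rangle_{L^2(\mathbb{R}_+)}\psi$. For $\alpha>0$ the Laguerre basis of $L^2(\mathbb{R}_+)$ is the orthonormal basis $$\mathcal{L}_n^{(\alpha)}(r)=\sqrt{\frac{n!}{\Gamma(n+\alpha+1)}}\,r^{\frac{\alpha+1}{2}}e^{-r/2}L_n^{(\alpha)}(r),\qquad n\ge0,$$ where $L_n^{(\alpha)}(r)=\sum_{k=0}^n(-1)^k\binom{n+\alpha}{n-k}\frac{r^k}{k!}$ are the generalized Laguerre polynomials. $\mathcal{D}\psi(r)=r^{1/2}\psi(r)$ and $\mathcal{D}^{-1}\psi(r)=r^{-1/2}\psi(r)$ are multiplication operators on $L^2(\mathbb{R}_+)$ with their maximal domains. A non-zero bounded operator $S$ on $L^2(\mathbb{R}_+)$ mapping $\mathrm{dom}(\mathcal{D})$ into $\mathrm{dom}(\mathcal{D}^{-1})$ is admissible if $\mathcal{D}^{-1}S\mathcal{D}^{-1}$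 is bounded on $\mathrm{dom}(\mathcal{D}^{-1})$ and extends to a trace-class operator, again denoted $\mathcal{D}^{-1}S\mathcal{D}^{-1}$. *)

(* Defs.v *)
From HB Require Import structures.
From mathcomp Require Import all_boot all_order all_algebra.
From mathcomp Require Import complex.
From mathcomp Require Import ring lra.
From mathcomp Require Import all_classical all_reals all_analysis.
From mathcomp Require Import measurable_realfun.

Set Implicit Arguments.
Unset Strict Implicit.
Unset Printing Implicit Defensive.
Import Order.TTheory GRing.Theory Num.Theory.
Import numFieldNormedType.Exports.

Local Open Scope classical_set_scope.
Local Open Scope ring_scope.

Definition Rplus (R : realType) : set R := `]0, +oo[%classic.
Arguments Rplus {R}.

(** * The complex Hilbert space L^2(R_+, dr/r)

   An element is represented by a function [R -> R[i]] of which only the values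
   on ]0, +oo[ matter, and functions that agree a.e. on ]0, +oo[ are
   identified.  Integrals against dr/r are Lebesgue integrals with the weight
   [r^-1]. *)

Section SquareIntegrable.
Variable R : realType.
Let mu := @lebesgue_measure R.

Definition isL2 (f : R -> R[i]) : Prop :=
  [/\ measurable_fun Rplus (fun r => complex.Re (f r)),
      measurable_fun Rplus (fun r => complex.Im (f r)) &
      (\int[mu]_(r in Rplus) (Normc.normc (f r) ^+ 2 / r)%:E < +oo)%E].

Definition L2pred : {pred R -> R[i]} := fun f => `[< isL2 f >].

Let normc2 (z : R[i]) :
  Normc.normc z ^+ 2 = complex.Re z ^+ 2 + complex.Im z ^+ 2.
Proof. by case: z => a b /=; rewrite sqr_sqrtr// addr_ge0// sqr_ge0. Qed.

Let ReD (a z w : R[i]) : complex.Re (a * z + w) =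
  complex.Re a * complex.Re z - complex.Im a * complex.Im z + complex.Re w.
Proof. by case: a z w => ? ? [? ?] [? ?]. Qed.

Let ImD (a z w : R[i]) : complex.Im (a * z + w) =
  complex.Re a * complex.Im z + complex.Im a * complex.Re z + complex.Im w.
Proof. by case: a z w => ? ? [? ?] [? ?]. Qed.

Let measurable_weight (f : R -> R[i]) :
  measurable_fun Rplus (fun r => complex.Re (f r)) ->
  measurable_fun Rplus (fun r => complex.Im (f r)) ->
  measurable_fun Rplus (fun r : R => (Normc.normc (f r) ^+ 2 / r) : R).
Proof.
move=> mf mg; apply: measurable_funM.
  under eq_fun do rewrite normc2.
  by apply: measurable_funD; exact: measurable_funX.
apply: open_continuous_measurable_fun; first exact: interval_open.
by move=> x; rewrite inE /Rplus/= in_itv/= andbT => x0; apply: inv_continuous; rewrite gt_eqF.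
Qed.

Lemma L2pred_submod_closed : submod_closed L2pred.
Proof.
split.
  apply/asboolP; split.
  - exact: measurable_cst.
  - exact: measurable_cst.
  - rewrite (eq_integral (cst 0%E)) ?integral0// => r _.
    by rewrite normc2 /= !expr0n/= addr0 mul0r.
move=> a f g /asboolP[mf1 mf2 If] /asboolP[mg1 mg2 Ig]; apply/asboolP.
have ReE r : complex.Re ((a *: f + g) r) = _ := ReD a (f r) (g r).
have ImE r : complex.Im ((a *: f + g) r) = _ := ImD a (f r) (g r).
have m1 : measurable_fun Rplus (fun r => complex.Re ((a *: f + g) r)).
  under eq_fun do rewrite ReE.
  apply: measurable_funD => //; apply: measurable_funB; apply: measurable_funM => //;
  exact: measurable_cst.
have m2 : measurable_fun Rplus (fun r => complex.Im ((a *: f + g) r)).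
  under eq_fun do rewrite ImE.
  apply: measurable_funD => //; apply: measurable_funD; apply: measurable_funM => //;
  exact: measurable_cst.
split=> //.
pose c := 2 * Normc.normc a ^+ 2.
have c0 : 0 <= c by rewrite mulr_ge0// sqr_ge0.
have w0 (h : R -> R[i]) r : Rplus r ->
    (0 <= (Normc.normc (h r) ^+ 2 / r)%:E)%E.
  by rewrite /Rplus/= in_itv/= andbT lee_fin => r0; rewrite divr_ge0 ?sqr_ge0// ltW.
have mw f' a1 a2 := (measurable_EFinP _ _).2 (@measurable_weight f' a1 a2).
apply: (@le_lt_trans _ _ (\int[mu]_(r in Rplus)
  (c%:E * (Normc.normc (f r) ^+ 2 / r)%:E +
   2%:E * (Normc.normc (g r) ^+ 2 / r)%:E))%E).
  apply: ge0_le_integral => //.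
  - exact: measurable_itv.
  - by move=> r; exact: w0.
  - exact: mw.
  - by apply: emeasurable_funD; apply: measurable_funeM; exact: mw.
  move=> r; rewrite /Rplus/= in_itv/= andbT => r0.
  rewrite -!EFinM -EFinD lee_fin.
  rewrite [c * _]mulrA [2 * _]mulrA -mulrDl; apply: ler_pM => //.
  - exact: sqr_ge0.
  - by rewrite invr_ge0 ltW.
  rewrite /c !normc2 ReE ImE.
  move: (complex.Re a) (complex.Im a) (complex.Re (f r)) (complex.Im (f r))
    (complex.Re (g r)) (complex.Im (g r)) => a1 a2 f1 f2 g1 g2.
  rewrite -subr_ge0; set d := (X in 0 <= X).
  have -> : d = (a1 * f1 - a2 * f2 - g1) ^+ 2 + (a1 * f2 + a2 * f1 - g2) ^+ 2.
    by rewrite /d; ring.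
  by rewrite addr_ge0// sqr_ge0.
have mR : measurable (Rplus : set R) by exact: measurable_itv.
have I0 (h : R -> R[i]) (k : R) : (0 <= k)%R -> forall r : R, Rplus r ->
    (0 <= k%:E * (Normc.normc (h r) ^+ 2 / r)%:E)%E.
  by move=> k0 r r0; apply: mule_ge0; [rewrite lee_fin | exact: w0].
rewrite ge0_integralD//; first last.
- by apply: measurable_funeM; exact: mw.
- exact: I0.
- by apply: measurable_funeM; exact: mw.
- exact: I0.
rewrite !ge0_integralZl_EFin//; first last.
- exact: mw.
- exact: w0.
- exact: mw.
- exact: w0.
by rewrite lte_add_pinfty// lte_mul_pinfty// lee_fin.
Qed.

End SquareIntegrable.

HB.instance Definition _ (R : realType) :=
  GRing.isSubmodClosed.Build _ _ (@L2pred R) (@L2pred_submod_closed R).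

Record L2fun (R : realType) := MkL2fun {
  L2val :> R -> R[i]; L2valP : L2val \in @L2pred R }.
HB.instance Definition _ (R : realType) := [isSub for @L2val R].
HB.instance Definition _ (R : realType) := [Choice of L2fun R by <:].
HB.instance Definition _ (R : realType) :=
  [SubChoice_isSubLmodule of L2fun R by <:].

Section NullFunctions.
Variable R : realType.

Definition L2null : {pred L2fun R} :=
  fun f => `[< (f : R -> R[i]) = cst 0 %[ae @lebesgue_measure R in Rplus] >].

Lemma L2null_submod_closed : submod_closed L2null.
Proof.
split; first by apply/asboolP; exact: aeW.
move=> a f g /asboolP f0 /asboolP g0; apply/asboolP.
have F := @ae_filter_ringOfSetsType _ _ _ (@lebesgue_measure R).
apply: (@filterS2 _ _ F _ _ _ _ f0 g0) => r {}f0 {}g0 r0.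
have -> : (a *: f + g) r = a * f r + g r by [].
by rewrite f0// g0// mulr0 addr0.
Qed.

HB.instance Definition _ :=
  GRing.isSubmodClosed.Build _ _ L2null L2null_submod_closed.

End NullFunctions.

Definition L2 (R : realType) : Type := Quotient.quot (@L2null R).
HB.instance Definition _ (R : realType) := Choice.on (L2 R).
HB.instance Definition _ (R : realType) :=
  EqQuotient.on (L2 R).
HB.instance Definition _ (R : realType) := GRing.Zmodule.on (L2 R).

Section L2Module.
Variable R : realType.
Local Open Scope quotient_scope.
Implicit Types (a b : R[i]) (f g : L2fun R) (u v : L2 R).

Definition L2scale a u : L2 R := \pi_(L2 R) (a *: repr u).

Let eq_pi f g : f - g \in @L2null R -> \pi_(L2 R) f = \pi_(L2 R) g.
Proof. by move=> fg; apply/eqP; rewrite -Quotient.idealrBE. Qed.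

Let pi_eq f g : \pi_(L2 R) f = \pi_(L2 R) g -> f - g \in @L2null R.
Proof. by move=> /eqP; rewrite -Quotient.idealrBE. Qed.

Let piD f g : \pi_(L2 R) (f + g) = \pi_(L2 R) f + \pi_(L2 R) g.
Proof. exact: Quotient.pi_add. Qed.

Let piZ a f : \pi_(L2 R) (a *: f) = L2scale a (\pi_(L2 R) f).
Proof.
rewrite /L2scale; apply: eq_pi; rewrite -scalerBr; apply: rpredZ; apply: pi_eq.
by rewrite reprK.
Qed.

Let ex_pi u : exists f, u = \pi_(L2 R) f.
Proof. by exists (repr u); rewrite reprK. Qed.

Let scaleA a b u : L2scale a (L2scale b u) = L2scale (a * b) u.
Proof.
by case: (ex_pi u) => f ->; rewrite -(piZ b f) -(piZ a) -(piZ (a * b)) scalerA.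
Qed.

Let scale1 : left_id 1 L2scale.
Proof. by move=> u; case: (ex_pi u) => f ->; rewrite -piZ scale1r. Qed.

Let scaleDr : right_distributive L2scale +%R.
Proof.
move=> a u v; case: (ex_pi u) => f ->; case: (ex_pi v) => g ->.
by rewrite -piD -!piZ -piD scalerDr.
Qed.

Let scaleDl u : {morph L2scale^~ u : a b / a + b}.
Proof.
by move=> a b; case: (ex_pi u) => f ->; rewrite -!piZ -piD scalerDl.
Qed.

HB.instance Definition _ :=
  GRing.Zmodule_isLmodule.Build R[i] (L2 R) scaleA scale1 scaleDr scaleDl.

(* The class of [f] if [f] is square integrable, and 0 otherwise. *)
Definition toL2 (f : R -> R[i]) : L2 R := \pi_(L2 R) (insubd (0 : L2fun R) f).

Definition L2repr (u : L2 R) : R -> R[i] := repr u.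

(* <u, v> is linear in [u] and antilinear in [v]. *)
Definition L2inner u v : R[i] :=
  let h := fun r => L2repr u r * conjc (L2repr v r) in
  Complex (\int[@lebesgue_measure R]_(r in Rplus) (complex.Re (h r) / r))
          (\int[@lebesgue_measure R]_(r in Rplus) (complex.Im (h r) / r)).

Definition L2norm u : R := Num.sqrt
  (\int[@lebesgue_measure R]_(r in Rplus) (Normc.normc (L2repr u r) ^+ 2 / r)).

End L2Module.

Section Operators.
Variable R : realType.
Implicit Types (S T A : L2 R -> L2 R) (u v : L2 R) (e : nat -> L2 R).

Definition bounded_operator S : Prop :=
  linear S /\ exists C : R, forall u, L2norm (S u) <= C * L2norm u.

Definition rank_one (psi phi : L2 R) : L2 R -> L2 R :=
  fun xi => L2inner xi phi *: psi.

(* S is the sum of the series of the operators [F n], in operator norm. *)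
Definition operator_series (F : nat -> L2 R -> L2 R) S : Prop :=
  forall eps : R, 0 < eps -> \forall n \near \oo,
    forall u, L2norm (S u - \sum_(k < n) F k u) <= eps * L2norm u.

Definition orthonormal e : Prop :=
  forall i j : nat, L2inner (e i) (e j) = (i == j)%:R.

Definition orthonormal_basis e : Prop :=
  orthonormal e /\
  forall u (eps : R), 0 < eps -> exists n (c : 'I_n -> R[i]),
    L2norm (u - \sum_(i < n) c i *: e i) < eps.

(* A = |T|: A >= 0 and A ^ 2 = T^* T, the last identity being read weakly. *)
Definition operator_abs T A : Prop :=
  [/\ bounded_operator A,
      forall u, 0 <= L2inner (A u) u &
      forall u v, L2inner (A (A u)) v = L2inner (T u) (T v)].

Definition trace_class T : Prop :=
  bounded_operator T /\ exists2 A, operator_abs T A &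
    forall e, orthonormal_basis e ->
      (\sum_(0 <= n <oo) (complex.Re (L2inner (A (e n)) (e n)))%:E < +oo)%E.

Definition has_trace T (t : R[i]) : Prop :=
  forall e, orthonormal_basis e ->
    (series (fun n => L2inner (T (e n)) (e n)) : nat -> R[i]^o) @ \oo --> (t : R[i]^o).

End Operators.

Section Admissible.
Variable R : realType.
Local Open Scope complex_scope.
Implicit Types (w : R -> R) (u : L2 R) (S T : L2 R -> L2 R).

(* Multiplication by [w] on its maximal domain; 0 off the domain. *)
Definition mul_dom w : set (L2 R) :=
  [set u | isL2 (fun r => (w r)%:C * L2repr u r)].

Definition mul_op w u : L2 R := toL2 (fun r => (w r)%:C * L2repr u r).

Definition domD : set (L2 R) := mul_dom (fun r => r `^ (2^-1)).
Definition opD : L2 R -> L2 R := mul_op (fun r => r `^ (2^-1)).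
Definition domDinv : set (L2 R) := mul_dom (fun r => r `^ (- 2^-1)).
Definition opDinv : L2 R -> L2 R := mul_op (fun r => r `^ (- 2^-1)).

(* T extends D^-1 S D^-1, which is defined on dom(D^-1) as soon as S maps
   dom(D) into dom(D^-1), because D^-1 maps dom(D^-1) into dom(D). *)
Definition extends_DSD S T : Prop :=
  forall u, domDinv u -> T u = opDinv (S (opDinv u)).

Definition admissible S : Prop :=
  [/\ bounded_operator S,
      exists u, S u != 0,
      forall u, domD u -> domDinv (S u),
      exists C : R, forall u, domDinv u ->
        L2norm (opDinv (S (opDinv u))) <= C * L2norm u &
      exists2 T, trace_class T & extends_DSD S T].

End Admissible.

Section Laguerre.
Variable R : realType.
Local Open Scope complex_scope.
Implicit Types (x a r : R) (n : nat).

(* Euler's Gamma function, for a > 0. *)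
Definition Gamma a : R :=
  \int[@lebesgue_measure R]_(r in Rplus) (r `^ (a - 1) * expR (- r)).

Definition gen_binomial x (m : nat) : R :=
  (\prod_(j < m) (x - j%:R)) / m`!%:R.

Definition laguerre_poly a n r : R :=
  \sum_(k < n.+1)
    (-1) ^+ k * gen_binomial (n%:R + a) (n - k)%N * (r ^+ k / k`!%:R).

Definition laguerre_fun a n r : R :=
  Num.sqrt (n`!%:R / Gamma (n%:R + a + 1)) *
  r `^ ((a + 1) / 2) * expR (- r / 2) * laguerre_poly a n r.

Definition laguerre a n : L2 R := toL2 (fun r => (laguerre_fun a n r)%:C).

End Laguerre.

(* Main.v *)
Require Import Defs.
From HB Require Import structures.
From mathcomp Require Import all_boot all_order all_algebra.
From mathcomp Require Import complex.
From mathcomp Require Import all_classical all_reals all_analysis.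
From mathcomp Require Import ring lra measurable_realfun.

Set Implicit Arguments.
Unset Strict Implicit.
Unset Printing Implicit Defensive.
Import Order.TTheory GRing.Theory Num.Theory.
Import numFieldNormedType.Exports.

Local Open Scope classical_set_scope.
Local Open Scope ring_scope.
Local Open Scope complex_scope.

(** Write [L_n] for the Laguerre functions, [g_n = D^-1 L_n], and
    [u (x) v] for the rank-one operator [xi |-> <xi, v> u].  Everything rests on
    two numbers, [||L_n||^2 = 1] and [||g_n||^2 = 1 / alpha].

    Both are moments of the square of a Laguerre polynomial against the weight
    [r^(b - 1) e^-r], for [b = alpha + 1] and [b = alpha].  Expanding one factor
    reduces them to the first moments
      [int r^(b - 1) e^-r L_n^(alpha)(r) dr = Gamma(b) binom(n + alpha - b, n)]
    ([laguerre_moment]): the values [Gamma(b + k)] contribute the binomial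
    coefficients of [-b], and the sum over the coefficients of the polynomial is
    a Vandermonde convolution.  Replacing [b] by [b + k], the binomial
    coefficient vanishes for all but one [k]: only the leading coefficient of the
    other factor survives when [b = alpha + 1], only the constant one when
    [b = alpha].  The functional equation and the convergence of the Gamma
    integral are established on the way.

    The rest holds for arbitrary bounded sequences.  If [||f_n||] and [||h_n||]
    are bounded and [s] is summable, then [sum_n s_n h_n (x) f_n] converges in
    operator norm ([diag_op_exists]), by completeness of the space
    ([L2_summable]).  Three such sums are needed:
      [S = sum s_n L_n (x) L_n],   [B = sum s_n g_n (x) L_n],
      [T = sum s_n g_n (x) g_n].
    Since [D^-1] is closed ([Dinv_graph_closed]), [S] maps the whole space into
    the domain of [D^-1] and [D^-1 S = B]; since [D^-1] is symmetric,
    [<D^-1 u, L_n> = <u, g_n>], so [B D^-1 u = T u].  Thus [T] extends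
    [D^-1 S D^-1], and it is the only bounded extension because the domain of
    [D^-1] is dense ([cutoff_cvg], [bounded_operator_ext]).

    Finally [T] is symmetric and non-negative, hence its own absolute value, and
    for an orthonormal basis [e] Tonelli's theorem and Parseval's identity give
      [sum_n <T e_n, e_n> = sum_n sum_k s_k |<e_n, g_k>|^2
                          = sum_k s_k ||g_k||^2 = (1 / alpha) sum_k s_k]
    ([diag_op_sum_basis]), which shows at once that [T] is of trace class and
    what its trace is. *)

(** * The Gamma function *)

Section GammaFunction.
Variable R : realType.
Implicit Types (a b r : R) (n : nat).
Local Notation mu := (@lebesgue_measure R).

Lemma RplusE r : Rplus r = (0 < r).
Proof. by rewrite /Rplus /= in_itv /= andbT. Qed.

Lemma measurable_Rplus : measurable (Rplus : set (measurableTypeR R)).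
Proof. exact: measurable_itv. Qed.

Definition gamma_density a r : R := r `^ (a - 1) * expR (- r).

Lemma gamma_density_ge0 a r : 0 <= gamma_density a r.
Proof. by rewrite mulr_ge0 ?powR_ge0 ?expR_ge0. Qed.

Lemma measurable_gamma_density a : measurable_fun setT (gamma_density a).
Proof.
apply: measurable_funM; first exact: measurable_powR.
exact: measurableT_comp.
Qed.

Lemma is_derive_gamma_density a r : 0 < r ->
  is_derive r 1 (gamma_density (a + 1))
    (a * gamma_density a r - gamma_density (a + 1) r).
Proof.
move=> r0; rewrite /gamma_density addrK.
have := is_derive1_powR a r0 => d1.
have d2 : is_derive r 1 (fun x : R => expR (- x)) (- expR (- r)).
  apply: is_derive_eq.
  by rewrite /GRing.scale/= mulrN1.
apply: is_derive_eq.
by rewrite /GRing.scale/=; ring.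
Qed.

Lemma continuous_gamma_density a r : 0 < r ->
  {for r, continuous (gamma_density a)}.
Proof.
move=> r0; rewrite -[a](subrK 1).
have [d _] := is_derive_gamma_density (a - 1) r0.
exact/differentiable_continuous/derivable1_diffP.
Qed.

(** The intervals stay away from 0, where the density is unbounded for [a < 1],
    and from infinity, so that the fundamental theorem of calculus applies; as
    they increase, the integrals converge by monotone convergence. *)
Definition exhaust n : set R := `[n.+2%:R^-1, n.+2%:R]%classic.

Lemma exhaust_gt0 n r : exhaust n r -> 0 < r.
Proof. by rewrite /exhaust/= in_itv/= => /andP[+ _]; apply: lt_le_trans. Qed.

Lemma exhaust_lt n : n.+2%:R^-1 < n.+2%:R :> R.
Proof. by apply: (@lt_trans _ _ 1); rewrite ?invf_lt1 ?ltr1n. Qed.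

Lemma nondecreasing_exhaust : {homo exhaust : n m / (n <= m)%N >-> (n <= m)%O}.
Proof.
move=> n m nm; rewrite subsetEset /exhaust => r/=; rewrite !in_itv/= => /andP[r1 r2].
apply/andP; split; [apply: le_trans r1 | apply: (le_trans r2)].
  by rewrite lef_pV2 ?posrE// ler_nat.
by rewrite ler_nat.
Qed.

Lemma bigcup_exhaust : \bigcup_n exhaust n = Rplus.
Proof.
apply/seteqP; split=> r; first by case=> n _ /exhaust_gt0; rewrite RplusE.
rewrite RplusE => r0.
pose m := Num.truncn (r + r^-1).
exists m => //; rewrite /exhaust/= in_itv/=.
have V0 : 0 < r^-1 by rewrite invr_gt0.
have : r + r^-1 < m.+2%:R.
  by apply: (lt_trans (truncnS_gt _)); rewrite ltr_nat.
move=> h; apply/andP; split.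
  by rewrite -[leRHS]invrK lef_pV2 ?posrE//; lra.
by lra.
Qed.

Lemma integrable_exhaust a n :
  mu.-integrable (exhaust n) (EFin \o gamma_density a).
Proof.
apply: continuous_compact_integrable; first exact: segment_compact.
apply: continuous_in_subspaceT => r; rewrite inE => /exhaust_gt0.
exact: continuous_gamma_density.
Qed.

Definition truncated_Gamma a n : R := \int[mu]_(r in exhaust n) gamma_density a r.

(** Integration by parts, in the form of the fundamental theorem of calculus for
    [r^a e^-r].  With [a = 0] it also computes the integral of [e^-r]. *)
Lemma truncated_GammaD1 a n : truncated_Gamma (a + 1) n =
  a * truncated_Gamma a n
  - (gamma_density (a + 1) n.+2%:R - gamma_density (a + 1) n.+2%:R^-1).
Proof.
have mE : measurable (exhaust n : set (measurableTypeR R)) by exact: measurable_itv.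
have I1 := integrable_exhaust a n; have I2 := integrable_exhaust (a + 1) n.
have I3 : mu.-integrable (exhaust n) (EFin \o (fun r => a * gamma_density a r)).
  by have := integrableZl mE a I1; apply: eq_integrable.
have cG b r : 0 < r -> {for r, continuous (gamma_density b)}.
  exact: continuous_gamma_density.
have := @continuous_FTC2 R (fun r => a * gamma_density a r - gamma_density (a + 1) r)
  (gamma_density (a + 1)) _ _ (exhaust_lt n).
move=> H.
have {H} : (\int[mu]_(x in exhaust n)
   (a * gamma_density a x - gamma_density (a + 1) x)%:E =
  (gamma_density (a + 1) n.+2%:R)%:E - (gamma_density (a + 1) n.+2%:R^-1)%:E)%E.
  apply: H.
  - apply: continuous_in_subspaceT => r; rewrite inE => /exhaust_gt0 r0.
    apply: cvgB; last exact: cG.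
    by apply: cvgM; [exact: cvg_cst | exact: cG].
  - split.
    + move=> r; rewrite in_itv/= => /andP[r0 _].
      have {}r0 : 0 < r by apply: lt_trans r0.
      by have [] := is_derive_gamma_density a r0.
    + by apply: cvg_at_right_filter; apply: cG.
    + by apply: cvg_at_left_filter; apply: cG.
  - move=> r; rewrite in_itv/= => /andP[r0 _].
    have {}r0 : 0 < r by apply: lt_trans r0.
    rewrite derive1E.
    by have [_ ->] := is_derive_gamma_density a r0.
move=> /(congr1 fine) /=.
rewrite -/(Rintegral _ _ _) RintegralB// RintegralZl//.
rewrite -/(truncated_Gamma a n) -/(truncated_Gamma (a + 1) n) => <-.
by rewrite opprB addrCA subrr addr0.
Qed.

Lemma gamma_density_le_fact m a r : 1 <= r -> a <= m%:R ->
  gamma_density (a + 1) r <= m.+1`!%:R / r.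
Proof.
move=> r1 am; have r0 : 0 < r by apply: lt_le_trans r1.
rewrite /gamma_density addrK ler_pdivlMr// expRN.
rewrite mulrAC ler_pdivrMr ?expR_gt0//.
have h := expR_ge1Dxn m (ltW r0).
have f0 : 0 < m.+1`!%:R :> R by rewrite ltr0n fact_gt0.
apply: (@le_trans _ _ (r ^+ m.+1)).
  by rewrite exprSr ler_pM2r// -powR_mulrn ?(ltW r0)//; apply: ler_powR.
have : r ^+ m.+1 / m.+1`!%:R <= expR r by lra.
by rewrite ler_pdivrMr// mulrC.
Qed.

Lemma truncated_Gamma_nat m : exists C, forall n, truncated_Gamma (m%:R + 1) n <= C.
Proof.
elim: m => [|m [C hC]].
  exists 1 => n; rewrite truncated_GammaD1 mul0r add0r opprB.
  have := gamma_density_ge0 (0 + 1) n.+2%:R.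
  have : gamma_density (0 + 1) n.+2%:R^-1 <= 1.
    rewrite /gamma_density addrK powRr0 mul1r -[leRHS]expR0 ler_expR.
    by rewrite lerNl oppr0.
  by lra.
exists (m.+1%:R * C + 1) => n; rewrite truncated_GammaD1 opprB.
have := gamma_density_ge0 (m.+1%:R + 1) n.+2%:R.
have : gamma_density (m.+1%:R + 1) n.+2%:R^-1 <= 1.
  rewrite /gamma_density addrK powR_mulrn//.
  rewrite -[leRHS]mulr1; apply: ler_pM; rewrite ?expR_ge0 ?exprn_ge0 ?invr_ge0//.
  by rewrite exprn_ile1 ?invr_ge0// invf_le1 ?ler1n// ltr0n.
have : m.+1%:R * truncated_Gamma m.+1%:R n <= m.+1%:R * C.
  by rewrite ler_pM2l//; rewrite -natr1; exact: hC.
by lra.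
Qed.

Lemma gamma_density_le a b c r : 0 < r -> a <= b <= c ->
  gamma_density b r <= gamma_density a r + gamma_density c r.
Proof.
move=> r0 /andP[ab bc].
rewrite /gamma_density -mulrDl ler_pM2r ?expR_gt0//.
have [r1|r1] := leP r 1.
  have := powR_ge0 r (c - 1).
  have : r `^ (b - 1) <= r `^ (a - 1) by apply: ger_powR; [rewrite r0 | lra].
  by lra.
have := powR_ge0 r (a - 1).
have : r `^ (b - 1) <= r `^ (c - 1) by apply: ler_powR; lra.
by lra.
Qed.

(** The recurrence read backwards bounds the integral for [a] by the one for
    [a + 1 >= 1], whose density is at most the sum of the densities for 1 and for
    an integer [m + 1 >= a + 1]. *)
Lemma truncated_Gamma_bounded a : 0 < a -> exists C, forall n, truncated_Gamma a n <= C.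
Proof.
move=> a0.
have mE n : measurable (exhaust n : set (measurableTypeR R)) by exact: measurable_itv.
have [m am] : exists m : nat, a <= m%:R.
  by exists (Num.truncn a).+1; apply/ltW/truncnS_gt.
have [C0 h0] := truncated_Gamma_nat 0; have [C1 h1] := truncated_Gamma_nat m.
exists ((C0 + C1 + m.+1`!%:R) / a) => n.
rewrite ler_pdivlMr// mulrC.
have := truncated_GammaD1 a n.
have le1 : truncated_Gamma (a + 1) n <= C0 + C1.
  apply: le_trans (lerD (h0 n) (h1 n)).
  rewrite /truncated_Gamma -RintegralD//; [|exact: integrable_exhaust|exact: integrable_exhaust].
  apply: le_Rintegral => //; first exact: integrable_exhaust.
    by have := integrableD (mE n) (integrable_exhaust (0%:R + 1) n)
      (integrable_exhaust (m%:R + 1) n); apply: eq_integrable.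
  by move=> r /exhaust_gt0 r0; apply: gamma_density_le => //; lra.
have := gamma_density_ge0 (a + 1) n.+2%:R^-1.
have le2 : gamma_density (a + 1) n.+2%:R <= m.+1`!%:R.
  apply: (le_trans (gamma_density_le_fact _ am)); first by rewrite ler1n.
  by rewrite ler_pdivrMr// ler_peMr// ler1n.
move: (truncated_Gamma _ _) (truncated_Gamma _ _) (gamma_density _ _)
  (gamma_density _ _) le1 le2 => A B C D.
by lra.
Qed.

Lemma integral_exhaust_cvg a :
  (\int[mu]_(r in exhaust n) (gamma_density a r)%:E)%E @[n --> \oo] -->
  (\int[mu]_(r in Rplus) (gamma_density a r)%:E)%E.
Proof.
rewrite -bigcup_exhaust; apply: ge0_nondecreasing_set_cvg_integral.
- exact: nondecreasing_exhaust.
- by move=> n; exact: measurable_itv.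
- by move=> n; apply/measurable_EFinP; apply: measurable_funTS; exact: measurable_gamma_density.
- by move=> n r _; rewrite lee_fin gamma_density_ge0.
Qed.

Lemma integrable_gamma_density a : 0 < a ->
  mu.-integrable Rplus (EFin \o gamma_density a).
Proof.
move=> a0; apply/integrableP; split.
  by apply/measurable_EFinP; apply: measurable_funTS; exact: measurable_gamma_density.
have [C hC] := truncated_Gamma_bounded a0.
apply: (@le_lt_trans _ _ C%:E); last by rewrite ltry.
rewrite (@eq_integral _ _ _ mu _ (fun r => (gamma_density a r)%:E)); last first.
  by move=> r _ /=; rewrite ger0_norm ?gamma_density_ge0.
have /cvg_lim <- // := @integral_exhaust_cvg a.
apply: lime_le; first by apply/cvg_ex; eexists; exact: integral_exhaust_cvg.
apply: nearW => n.
rewrite -[leLHS]fineK; first by rewrite lee_fin; exact: hC.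
by apply: integrable_fin_num; [exact: measurable_itv | exact: integrable_exhaust].
Qed.

Lemma truncated_Gamma_cvg a : 0 < a -> truncated_Gamma a @ \oo --> Gamma a.
Proof.
move=> a0; apply: fine_cvg; rewrite /= fineK; first exact: integral_exhaust_cvg.
apply: integrable_fin_num; first exact: measurable_Rplus.
exact: integrable_gamma_density.
Qed.

Lemma GammaD1 a : 0 < a -> Gamma (a + 1) = a * Gamma a.
Proof.
move=> a0.
have b1 : gamma_density (a + 1) n.+2%:R @[n --> \oo] --> (0 : R).
  have [m am] : exists m : nat, a <= m%:R.
    by exists (Num.truncn a).+1; apply/ltW/truncnS_gt.
  apply: (@squeeze_cvgr _ _ _ _ (fun=> 0) (fun n => m.+1`!%:R * harmonic n.+1)).
  - apply: nearW => n; rewrite gamma_density_ge0/=.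
    by apply: (gamma_density_le_fact _ am); rewrite ler1n.
  - exact: cvg_cst.
  - rewrite -[X in _ --> X](mulr0 m.+1`!%:R).
    apply: cvgM; first exact: cvg_cst.
    by rewrite (cvg_shiftS (@harmonic R)); exact: cvg_harmonic.
have b2 : gamma_density (a + 1) n.+2%:R^-1 @[n --> \oo] --> (0 : R).
  rewrite /gamma_density addrK.
  apply: (@squeeze_cvgr _ _ _ _ (fun=> 0) (fun n : nat => n.+2%:R^-1 `^ a)).
  - apply: nearW => n; rewrite mulr_ge0 ?expR_ge0 ?powR_ge0//=.
    by rewrite ler_piMr ?powR_ge0// -[leRHS]expR0 ler_expR lerNl oppr0.
  - exact: cvg_cst.
  - have := @powR_cvg0 R a a0.
    move/cvg_at_rightP => /(_ (fun n : nat => n.+2%:R^-1)); apply.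
    split=> // .
    by have := @cvg_harmonic R; rewrite -(cvg_shiftS (@harmonic R)).
have h1 := truncated_Gamma_cvg a0.
have a10 : 0 < a + 1 by lra.
have h2 := truncated_Gamma_cvg a10.
have h3 : truncated_Gamma (a + 1) @ \oo --> a * Gamma a - (0 - 0).
  rewrite (funext (truncated_GammaD1 a)).
  have h4 : a * truncated_Gamma a n @[n --> \oo] --> a * Gamma a.
    by apply: cvgM; [exact: cvg_cst | exact: h1].
  exact: (cvgB h4 (cvgB b1 b2)).
have := cvg_lim (@norm_hausdorff _ R) h2.
by rewrite (cvg_lim (@norm_hausdorff _ R) h3) !subr0 => <-.
Qed.

Lemma le_truncated_Gamma a n : 0 < a -> truncated_Gamma a n <= Gamma a.
Proof.
move=> a0; have mE : measurable (exhaust n : set (measurableTypeR R)) by exact: measurable_itv.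
rewrite /truncated_Gamma /Gamma /Rintegral fine_le//.
- by apply: integrable_fin_num => //; exact: integrable_exhaust.
- apply: integrable_fin_num; first exact: measurable_Rplus.
  exact: integrable_gamma_density.
apply: ge0_subset_integral => //; first exact: measurable_Rplus.
- by apply/measurable_EFinP; apply: measurable_funTS; exact: measurable_gamma_density.
- by move=> r _; rewrite lee_fin gamma_density_ge0.
- by rewrite -bigcup_exhaust; exact: bigcup_sup.
Qed.

Lemma Gamma_gt0 a : 0 < a -> 0 < Gamma a.
Proof.
move=> a0; apply: lt_le_trans (le_truncated_Gamma 0 a0).
have mE : measurable (exhaust 0 : set (measurableTypeR R)) by exact: measurable_itv.
have [c cE cmin] : exists2 c, c \in `[2^-1, 2 : R] &
    forall t, t \in `[2^-1, 2] -> gamma_density a c <= gamma_density a t.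
  apply: EVT_min; first exact: ltW (exhaust_lt 0).
  apply: continuous_in_subspaceT => r; rewrite inE => /(@exhaust_gt0 0).
  exact: continuous_gamma_density.
have c0 : 0 < c by apply: (@exhaust_gt0 0).
apply: (@lt_le_trans _ _ (\int[mu]_(r in exhaust 0) gamma_density a c)).
  have mu_gt0 : 0 < fine (mu (exhaust 0)).
    rewrite /exhaust lebesgue_measure_itv/= lte_fin (exhaust_lt 0) -EFinD/=.
    by rewrite subr_gt0; exact: exhaust_lt 0.
  rewrite Rintegral_cst//; apply: mulr_gt0; last exact: mu_gt0.
  by rewrite mulr_gt0 ?expR_gt0 ?powR_gt0.
apply: le_Rintegral => //; last exact: integrable_exhaust.
apply: continuous_compact_integrable; first exact: segment_compact.
by apply: continuous_in_subspaceT => r _; exact: cvg_cst.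
Qed.
End GammaFunction.

(** * Generalized binomial coefficients *)

Section GeneralizedBinomial.
Variable R : realType.
Implicit Types (x y a : R) (n m k : nat).

Lemma gen_binomial0 x : gen_binomial x 0 = 1.
Proof. by rewrite /gen_binomial big_ord0 fact0 divr1. Qed.

Lemma gen_binomialS x n :
  n.+1%:R * gen_binomial x n.+1 = (x - n%:R) * gen_binomial x n.
Proof.
rewrite /gen_binomial big_ord_recr/= factS natrM.
have h1 : n`!%:R != 0 :> R by rewrite pnatr_eq0 -lt0n fact_gt0.
have h2 : n.+1%:R != 0 :> R by rewrite pnatr_eq0.
by field; rewrite h1 nat1r h2.
Qed.

(** Induction on [n]: multiplying by [n + 1 = (n + 1 - k) + k] lowers one of the
    two binomial coefficients in each term, and the factors that come out add up
    to [x + y - n]. *)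
Lemma gen_binomial_Vandermonde x y n : gen_binomial (x + y) n =
  \sum_(k < n.+1) gen_binomial x (n - k) * gen_binomial y k.
Proof.
elim: n => [|n IH]; first by rewrite big_ord1 !gen_binomial0 mulr1.
have n0 : n.+1%:R != 0 :> R by rewrite pnatr_eq0.
apply: (mulfI n0); rewrite gen_binomialS IH.
have -> : n.+1%:R * (\sum_(k < n.+2) gen_binomial x (n.+1 - k) * gen_binomial y k) =
    \sum_(k < n.+2) ((n.+1 - k)%:R * gen_binomial x (n.+1 - k)) * gen_binomial y k +
    \sum_(k < n.+2) gen_binomial x (n.+1 - k) * (k%:R * gen_binomial y k).
  rewrite -big_split/= mulr_sumr; apply: eq_bigr => k _.
  by rewrite natrB; [ring | rewrite -ltnS].
rewrite [X in _ = X + _]big_ord_recr/= subnn ?mulr0n !mul0r addr0 [X in _ = _ + X]big_ord_recl/= ?mulr0n mul0r mulr0 add0r.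
rewrite -big_split/= mulr_sumr; apply: eq_bigr => k _.
have kn : (k <= n)%N by rewrite -ltnS.
rewrite /bump leq0n add1n subSS gen_binomialS.
by rewrite (subSn kn) gen_binomialS (natrB _ kn); ring.
Qed.

Lemma gen_binomial_small m n : (m < n)%N -> gen_binomial (m%:R : R) n = 0.
Proof.
move=> mn; rewrite /gen_binomial (bigD1 (Ordinal mn))//= subrr.
by rewrite !mul0r.
Qed.

Lemma gen_binomialSS x n : n.+1%:R * gen_binomial (x + 1) n.+1 = (x + 1) * gen_binomial x n.
Proof.
rewrite /gen_binomial big_ord_recl/= subr0 factS natrM.
have -> : \prod_(j < n) (x + 1 - (bump 0 j)%:R) = \prod_(j < n) (x - j%:R).
  by apply: eq_bigr => j _; rewrite /bump leq0n add1n -natr1; ring.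
have h1 : n`!%:R != 0 :> R by rewrite pnatr_eq0 -lt0n fact_gt0.
have h2 : n.+1%:R != 0 :> R by rewrite pnatr_eq0.
by field; rewrite h1 nat1r h2.
Qed.

Lemma gen_binomialnn n : gen_binomial (n%:R : R) n = 1.
Proof.
elim: n => [|n IH]; first exact: gen_binomial0.
have n0 : n.+1%:R != 0 :> R by rewrite pnatr_eq0.
by apply: (mulfI n0); rewrite -[in gen_binomial _]natr1 gen_binomialSS IH natr1.
Qed.

Lemma gen_binomialN1 n : gen_binomial (-1 : R) n = (-1) ^+ n.
Proof.
elim: n => [|n IH]; first exact: gen_binomial0.
have n0 : n.+1%:R != 0 :> R by rewrite pnatr_eq0.
apply: (mulfI n0); rewrite gen_binomialS IH exprS -natr1; ring.
Qed.

(** The rising factorial [a (a + 1) ... (a + n - 1)] is written with the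
    binomial coefficient of [- a], ready for a Vandermonde convolution. *)
Lemma GammaDn a n : 0 < a ->
  Gamma (a + n%:R) = Gamma a * ((-1) ^+ n * n`!%:R * gen_binomial (- a) n).
Proof.
move=> a0; elim: n => [|n IH].
  by rewrite gen_binomial0 fact0 addr0 !mulr1.
rewrite -natr1 addrA GammaD1 ?ltr_wpDr// IH factS natrM exprS.
have := gen_binomialS (- a) n.
move: (gen_binomial (- a) n) (gen_binomial (- a) n.+1) => B0 B1 h.
transitivity (Gamma a * (- ((-1) ^+ n)) * n`!%:R * (n.+1%:R * B1)).
  by rewrite h; ring.
by ring.
Qed.

Lemma GammaDn_gen_binomial a n : 0 < a ->
  Gamma (n%:R + a + 1) = Gamma (a + 1) * n`!%:R * gen_binomial (n%:R + a) n.
Proof.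
move=> a0; elim: n => [|n IH].
  by rewrite gen_binomial0 fact0 add0r !mulr1.
have h := gen_binomialSS (n%:R + a) n.
rewrite -[in LHS]natr1 -[in gen_binomial _ _]natr1 [_ + 1 + a]addrAC [LHS]GammaD1.
  rewrite IH factS natrM; move: h.
  move: (gen_binomial (n%:R + a) n) (gen_binomial (n%:R + a + 1) n.+1) => B0 B1 h.
  transitivity (Gamma (a + 1) * n`!%:R * (n.+1%:R * B1)); last by ring.
  by rewrite h; ring.
by rewrite ltr_wpDl// addr_ge0// ltW.
Qed.

End GeneralizedBinomial.

(** * Moments of the Laguerre polynomials *)

Section LaguerreMoments.
Variable R : realType.
Implicit Types (a b r : R) (n m k : nat).
Local Notation mu := (@lebesgue_measure R).

Lemma Rintegral_lincomb n (c : nat -> R) (f : nat -> R -> R) :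
  (forall k, mu.-integrable Rplus (EFin \o f k)) ->
  mu.-integrable Rplus (EFin \o (fun r => \sum_(k < n) c k * f k r)) /\
  \int[mu]_(r in Rplus) (\sum_(k < n) c k * f k r) =
  \sum_(k < n) c k * \int[mu]_(r in Rplus) f k r.
Proof.
move=> If; have mR := @measurable_Rplus R.
have Icf k : mu.-integrable Rplus (EFin \o (fun r => c k * f k r)).
  by have := integrableZl mR (c k) (If k); apply: eq_integrable.
elim: n => [|n [IH1 IH2]].
  have E r : \sum_(k < 0) c k * f k r = 0 by rewrite big_ord0.
  split; first by under eq_fun do rewrite E; exact: integrable0.
  by under eq_Rintegral do rewrite E; rewrite big_ord0 Rintegral_cst// mul0r.
have E : (fun r => \sum_(k < n.+1) c k * f k r) =
    (fun r => \sum_(k < n) c k * f k r + c n * f n r).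
  by apply/funext => r; rewrite big_ord_recr.
rewrite E big_ord_recr/= -IH2; split.
  by have := integrableD mR IH1 (Icf n); apply: eq_integrable.
by rewrite RintegralD// [X in _ + X = _]RintegralZl.
Qed.

Definition laguerre_coef a n k : R :=
  (-1) ^+ k * gen_binomial (n%:R + a) (n - k) / k`!%:R.

Lemma laguerre_polyE a n r :
  laguerre_poly a n r = \sum_(k < n.+1) laguerre_coef a n k * r ^+ k.
Proof. by apply: eq_bigr => k _; rewrite /laguerre_coef; ring. Qed.

Lemma gamma_densityDn b k r : 0 < r ->
  gamma_density (b + k%:R) r = r ^+ k * gamma_density b r.
Proof.
move=> r0; rewrite /gamma_density mulrA addrAC [in LHS]powRD ?(gt_eqF r0) ?implybT//.
by rewrite powR_mulrn ?(ltW r0)// [r ^+ k * _]mulrC.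
Qed.

Lemma gamma_densityD1 b r : 0 < r -> gamma_density (b + 1) r = r * gamma_density b r.
Proof. exact: (@gamma_densityDn b 1). Qed.

(** The factor [1 / k!] and the sign of the coefficient of [r^k] cancel against
    those of [Gamma (b + k)], which leaves a Vandermonde convolution. *)
Lemma laguerre_moment a b n : 0 < b ->
  mu.-integrable Rplus (EFin \o (fun r => laguerre_poly a n r * gamma_density b r)) /\
  \int[mu]_(r in Rplus) (laguerre_poly a n r * gamma_density b r) =
  Gamma b * gen_binomial (n%:R + a - b) n.
Proof.
move=> b0.
have Ib k : mu.-integrable Rplus (EFin \o gamma_density (b + k%:R)).
  by apply: integrable_gamma_density; rewrite ltr_wpDr.
have [I1 I2] := Rintegral_lincomb n.+1 (laguerre_coef a n) Ib.
have E : {in Rplus, (fun r => \sum_(k < n.+1) laguerre_coef a n k * gamma_density (b + k%:R) r)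
   =1 (fun r => laguerre_poly a n r * gamma_density b r)}.
  move=> r; rewrite inE RplusE => r0; rewrite laguerre_polyE mulr_suml.
  by apply: eq_bigr => k _; rewrite gamma_densityDn// mulrA.
split.
  apply: eq_integrable I1; first exact: measurable_Rplus.
  by move=> r rR /=; rewrite E.
rewrite -(eq_Rintegral mu E) I2 gen_binomial_Vandermonde mulr_sumr.
apply: eq_bigr => k _; rewrite -/(Gamma (b + k%:R)) GammaDn// /laguerre_coef.
have h1 : k`!%:R != 0 :> R by rewrite pnatr_eq0 -lt0n fact_gt0.
have h2 : (-1) ^+ k * (-1) ^+ k = 1 :> R by rewrite -exprMn mulrNN mulr1 expr1n.
transitivity (((-1) ^+ k * (-1) ^+ k) * (Gamma b * (gen_binomial (n%:R + a) (n - k) * gen_binomial (- b) k))).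
  by field.
by rewrite h2 mul1r.
Qed.

Lemma laguerre_sqr_moment a b n : 0 < b ->
  mu.-integrable Rplus (EFin \o (fun r => laguerre_poly a n r ^+ 2 * gamma_density b r)) /\
  \int[mu]_(r in Rplus) (laguerre_poly a n r ^+ 2 * gamma_density b r) =
  \sum_(k < n.+1) laguerre_coef a n k * (Gamma (b + k%:R) *
     gen_binomial (n%:R + a - (b + k%:R)) n).
Proof.
move=> b0.
have bk k : 0 < b + k%:R by rewrite ltr_wpDr.
pose f k r := laguerre_poly a n r * gamma_density (b + k%:R) r.
have If k : mu.-integrable Rplus (EFin \o f k) by have [] := laguerre_moment a n (bk k).
have [I1 I2] := Rintegral_lincomb n.+1 (laguerre_coef a n) If.
have E : {in Rplus, (fun r => \sum_(k < n.+1) laguerre_coef a n k * f k r)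
   =1 (fun r => laguerre_poly a n r ^+ 2 * gamma_density b r)}.
  move=> r; rewrite inE RplusE => r0; rewrite expr2 {1}laguerre_polyE !mulr_suml.
  by apply: eq_bigr => k _; rewrite /f gamma_densityDn//; ring.
split.
  apply: eq_integrable I1; first exact: measurable_Rplus.
  by move=> r rR /=; rewrite E.
rewrite -(eq_Rintegral mu E) I2.
by apply: eq_bigr => k _; rewrite /f; have [_ ->] := laguerre_moment a n (bk k).
Qed.

(** Orthogonality to the lower powers: the factor of index [k < n] is
    [binom(n - 1 - k, n) = 0], and [k = n] gives [binom(-1, n) = (-1)^n]. *)
Lemma laguerre_sqr_momentD1 a n : 0 < a ->
  \int[mu]_(r in Rplus) (laguerre_poly a n r ^+ 2 * gamma_density (a + 1) r) =
  Gamma (n%:R + a + 1) / n`!%:R.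
Proof.
move=> a0; have [_ ->] := laguerre_sqr_moment a n (addr_gt0 a0 ltr01).
rewrite big_ord_recr/= big1 ?add0r => [|[k kn] _ /=]; last first.
  have -> : n%:R + a - (a + 1 + k%:R) = (n.-1 - k)%:R :> R.
    case: n kn => // n kn; rewrite natrB// -natr1/=; ring.
  rewrite gen_binomial_small ?mulr0//.
  by case: n kn => // n kn /=; rewrite ltnS leq_subr.
rewrite /laguerre_coef subnn gen_binomial0.
have -> : n%:R + a - (a + 1 + n%:R) = -1 :> R by ring.
rewrite gen_binomialN1.
have -> : n%:R + a + 1 = a + 1 + n%:R :> R by ring.
have h2 : (-1) ^+ n * (-1) ^+ n = 1 :> R by rewrite -exprMn mulrNN mulr1 expr1n.
move: ((-1) ^+ n) (Gamma _) h2 => s G h2; rewrite mulr1.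
by transitivity (s * s * (G / n`!%:R)); [ring | rewrite h2 mul1r].
Qed.

(** With one power of [r] less, the factor of index [k] is [binom(n - k, n)],
    which vanishes unless [k = 0]. *)
Lemma laguerre_sqr_moment0 a n : 0 < a ->
  \int[mu]_(r in Rplus) (laguerre_poly a n r ^+ 2 * gamma_density a r) =
  Gamma (n%:R + a + 1) / n`!%:R / a.
Proof.
move=> a0; have [_ ->] := laguerre_sqr_moment a n a0.
rewrite big_ord_recl/= big1 ?addr0 => [|[k kn] _ /=]; last first.
  have -> : n%:R + a - (a + (bump 0 k)%:R) = (n - k.+1)%:R :> R.
    by rewrite natrB// /bump leq0n add1n; ring.
  rewrite gen_binomial_small ?mulr0//.
  by case: n kn => // n kn /=; rewrite subSS ltnS leq_subr.
rewrite /laguerre_coef subn0 expr0 mul1r fact0 divr1 (addrK a) gen_binomialnn mulr1.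
rewrite GammaDn_gen_binomial// GammaD1//.
have h1 : n`!%:R != 0 :> R by rewrite pnatr_eq0 -lt0n fact_gt0.
have a1 : a != 0 by rewrite gt_eqF.
by move: (gen_binomial _ _) (Gamma a) => B G; field; rewrite h1 a1.
Qed.

Lemma laguerre_fun_sqr a n r : 0 < a -> 0 < r ->
  laguerre_fun a n r ^+ 2 / r = n`!%:R / Gamma (n%:R + a + 1) *
    (laguerre_poly a n r ^+ 2 * gamma_density (a + 1) r).
Proof.
move=> a0 r0; rewrite /laguerre_fun !exprMn sqr_sqrtr; last first.
  by rewrite divr_ge0// ltW// Gamma_gt0// addr_gt0// ltr_wpDl.
have -> : (r `^ ((a + 1) / 2)) ^+ 2 = r `^ (a + 1).
  by rewrite -powR_mulrn ?powR_ge0// -powRrM divfK.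
have -> : expR (- r / 2) ^+ 2 = expR (- r).
  by rewrite -expRM_natl mulrCA mulfV// mulr1.
rewrite /gamma_density addrK [r `^ (a + 1)]powRD ?(gt_eqF r0) ?implybT//.
rewrite powRr1 ?(ltW r0)//.
have r1 : r != 0 by rewrite gt_eqF.
move: (_ / Gamma _) (laguerre_poly _ _ _) (expR _) (r `^ a) => A B C D.
by field.
Qed.

Lemma powR_half_sqr r : 0 < r -> (r `^ (- 2^-1)) ^+ 2 = r^-1.
Proof.
move=> r0; rewrite -powR_mulrn ?powR_ge0// -powRrM mulNr mulVf//.
by rewrite powR_inv1// ltW.
Qed.

Lemma Dinv_laguerre_fun_sqr a n r : 0 < a -> 0 < r ->
  (r `^ (- 2^-1) * laguerre_fun a n r) ^+ 2 / r = n`!%:R / Gamma (n%:R + a + 1) *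
    (laguerre_poly a n r ^+ 2 * gamma_density a r).
Proof.
move=> a0 r0; rewrite exprMn powR_half_sqr// -[LHS]mulrA laguerre_fun_sqr//.
have r1 : r != 0 by rewrite gt_eqF.
rewrite gamma_densityD1//.
move: (_ / Gamma _) (laguerre_poly _ _ _) (gamma_density _ _) => A B C.
by field.
Qed.

Lemma integral_laguerre_fun_sqr a n : 0 < a ->
  mu.-integrable Rplus (EFin \o (fun r => laguerre_fun a n r ^+ 2 / r)) /\
  \int[mu]_(r in Rplus) (laguerre_fun a n r ^+ 2 / r) = 1.
Proof.
move=> a0; have mR := @measurable_Rplus R.
have [I1 _] := laguerre_sqr_moment a n (addr_gt0 a0 ltr01).
have E : {in Rplus, (fun r => n`!%:R / Gamma (n%:R + a + 1) *
    (laguerre_poly a n r ^+ 2 * gamma_density (a + 1) r)) =1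
    (fun r => laguerre_fun a n r ^+ 2 / r)}.
  by move=> r; rewrite inE RplusE => r0; rewrite laguerre_fun_sqr.
split.
  have := integrableZl mR (n`!%:R / Gamma (n%:R + a + 1)) I1.
  by apply: eq_integrable => // r rR /=; rewrite -EFinM E.
rewrite -(eq_Rintegral mu E) RintegralZl// laguerre_sqr_momentD1//.
have h1 : n`!%:R != 0 :> R by rewrite pnatr_eq0 -lt0n fact_gt0.
have h2 : Gamma (n%:R + a + 1) != 0.
  by rewrite gt_eqF// Gamma_gt0// addr_gt0// ltr_wpDl.
by move: (Gamma _) h2 => G h2; field; rewrite h1 h2.
Qed.

Lemma integral_Dinv_laguerre_fun_sqr a n : 0 < a ->
  mu.-integrable Rplus (EFin \o (fun r => (r `^ (- 2^-1) * laguerre_fun a n r) ^+ 2 / r)) /\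
  \int[mu]_(r in Rplus) ((r `^ (- 2^-1) * laguerre_fun a n r) ^+ 2 / r) = a^-1.
Proof.
move=> a0; have mR := @measurable_Rplus R.
have [I1 _] := laguerre_sqr_moment a n a0.
have E : {in Rplus, (fun r => n`!%:R / Gamma (n%:R + a + 1) *
    (laguerre_poly a n r ^+ 2 * gamma_density a r)) =1
    (fun r => (r `^ (- 2^-1) * laguerre_fun a n r) ^+ 2 / r)}.
  by move=> r; rewrite inE RplusE => r0; rewrite Dinv_laguerre_fun_sqr.
split.
  have := integrableZl mR (n`!%:R / Gamma (n%:R + a + 1)) I1.
  by apply: eq_integrable => // r rR /=; rewrite -EFinM E.
rewrite -(eq_Rintegral mu E) RintegralZl// laguerre_sqr_moment0//.
have h1 : n`!%:R != 0 :> R by rewrite pnatr_eq0 -lt0n fact_gt0.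
have h2 : Gamma (n%:R + a + 1) != 0.
  by rewrite gt_eqF// Gamma_gt0// addr_gt0// ltr_wpDl.
have h3 : a != 0 by rewrite gt_eqF.
by move: (Gamma _) h2 => G h2; field; rewrite h1 h2 h3.
Qed.

Lemma measurable_laguerre_fun a n : measurable_fun setT (laguerre_fun a n).
Proof.
apply: measurable_funM; last first.
  rewrite (funext (laguerre_polyE a n)); apply: measurable_sum => k.
  by apply: measurable_funM; [exact: measurable_cst | exact: measurable_funX].
apply: measurable_funM.
  by apply: measurable_funM; [exact: measurable_cst | exact: measurable_powR].
apply: measurableT_comp => //.
by apply: measurable_funM => //; exact: measurable_funN.
Qed.

End LaguerreMoments.

(** * Representatives of square-integrable classes *)

Section Representatives.
Variable R : realType.
Local Open Scope quotient_scope.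
Implicit Types (a : R[i]) (f g : R -> R[i]) (u v w : L2 R).
Local Notation mu := (@lebesgue_measure R).

Let F := @ae_filter_ringOfSetsType _ _ _ mu.

Lemma ae_imply (P Q : R -> Prop) : (forall r, P r -> Q r) ->
  {ae mu, forall r, P r} -> {ae mu, forall r, Q r}.
Proof. exact: (@filterS _ _ F). Qed.

Lemma ae_imply2 (P Q S : R -> Prop) : (forall r, P r -> Q r -> S r) ->
  {ae mu, forall r, P r} -> {ae mu, forall r, Q r} -> {ae mu, forall r, S r}.
Proof. exact: (@filterS2 _ _ F). Qed.

Lemma ae_and (P Q : R -> Prop) : {ae mu, forall r, P r} ->
  {ae mu, forall r, Q r} -> {ae mu, forall r, P r /\ Q r}.
Proof. by apply: ae_imply2 => r. Qed.

Definition aeq f g : Prop := f = g %[ae mu in Rplus].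

Lemma aeq_sym f g : aeq f g -> aeq g f.
Proof. exact: ae_eq_sym. Qed.

Lemma aeq_trans f g h : aeq f g -> aeq g h -> aeq f h.
Proof. exact: ae_eq_trans. Qed.

Lemma isL2_repr u : isL2 (L2repr u).
Proof. exact/asboolP/L2valP. Qed.

Lemma L2null_aeq (f g : L2fun R) : (f - g \in @L2null R) <-> aeq f g.
Proof.
split.
  move/asboolP; apply: ae_imply => r H rR; apply/eqP; rewrite -subr_eq0.
  by have /= <- := H rR.
move=> H; apply/asboolP; move: H; apply: ae_imply => r H rR.
by have -> : (f - g) r = f r - g r by []; rewrite H// subrr.
Qed.

Lemma pi_aeq (f g : L2fun R) : \pi_(L2 R) f = \pi_(L2 R) g <-> aeq f g.
Proof.
rewrite -L2null_aeq; split; first by move=> /eqP; rewrite -Quotient.idealrBE.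
by move=> fg; apply/eqP; rewrite -Quotient.idealrBE.
Qed.

Lemma L2repr_pi (f : L2fun R) : aeq (L2repr (\pi_(L2 R) f)) f.
Proof. by apply/pi_aeq; rewrite reprK. Qed.

Lemma L2_eq u v : aeq (L2repr u) (L2repr v) -> u = v.
Proof. by move=> /pi_aeq; rewrite !reprK. Qed.

Lemma L2repr_toL2 f : isL2 f -> aeq (L2repr (toL2 f)) f.
Proof.
move=> f2; rewrite /toL2; apply: aeq_trans (L2repr_pi _) _.
have fP : f \in @L2pred R by apply/asboolP.
have E : (insubd (0 : L2fun R) f : R -> R[i]) = f by rewrite -[LHS]/(val _) val_insubd fP.
by rewrite E; exact: ae_eq_refl.
Qed.

Lemma L2reprD u v : aeq (L2repr (u + v)) (fun r => L2repr u r + L2repr v r).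
Proof.
rewrite -{1}[u]reprK -{1}[v]reprK.
have <- : \pi_(L2 R) (repr u + repr v) = \pi_(L2 R) (repr u) + \pi_(L2 R) (repr v).
  exact: Quotient.pi_add.
exact: L2repr_pi.
Qed.

Lemma L2reprZ a u : aeq (L2repr (a *: u)) (fun r => a * L2repr u r).
Proof. exact: L2repr_pi. Qed.

Lemma L2repr0 : aeq (L2repr (0 : L2 R)) (fun=> 0).
Proof.
have := L2reprZ 0 0; rewrite scale0r => /aeq_trans; apply.
by apply: aeW => r _; rewrite mul0r.
Qed.

Lemma L2reprB u v : aeq (L2repr (u - v)) (fun r => L2repr u r - L2repr v r).
Proof.
have h := L2reprZ (-1) v; rewrite scaleN1r in h.
apply: ae_imply2 h (L2reprD u (- v)) => r h1 h2 r0.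
by rewrite h2// h1// mulN1r.
Qed.

Lemma L2repr_sum n (U : nat -> L2 R) :
  aeq (L2repr (\sum_(k < n) U k)) (fun r => \sum_(k < n) L2repr (U k) r).
Proof.
elim: n => [|n IH].
  rewrite big_ord0; apply: aeq_trans L2repr0 _.
  by apply: aeW => r _; rewrite big_ord0.
rewrite big_ord_recr/=.
apply: ae_imply2 IH (L2reprD (\sum_(i < n) U i) (U n)) => r h1 h2 r0.
by rewrite h2// h1// big_ord_recr.
Qed.

End Representatives.

(** * Integration of complex functions against dr/r *)

Section WeightedIntegral.
Variable R : realType.
Implicit Types (a : R[i]) (f g h k : R -> R[i]).
Local Notation mu := (@lebesgue_measure R).

Lemma normc2E (z : R[i]) :
  Normc.normc z ^+ 2 = complex.Re z ^+ 2 + complex.Im z ^+ 2.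
Proof. by case: z => x y /=; rewrite sqr_sqrtr// addr_ge0// sqr_ge0. Qed.

Lemma Re_mulconj (z w : R[i]) : complex.Re (z * conjc w) =
  complex.Re z * complex.Re w + complex.Im z * complex.Im w.
Proof. by case: z w => ? ? [? ?] /=; rewrite mulrN opprK. Qed.

Lemma Im_mulconj (z w : R[i]) : complex.Im (z * conjc w) =
  complex.Im z * complex.Re w - complex.Re z * complex.Im w.
Proof. by case: z w => ? ? [? ?] /=; rewrite mulrN addrC. Qed.

Lemma Re_mulc (z w : R[i]) : complex.Re (z * w) =
  complex.Re z * complex.Re w - complex.Im z * complex.Im w.
Proof. by case: z w => ? ? [? ?]. Qed.

Lemma Im_mulc (z w : R[i]) : complex.Im (z * w) =
  complex.Re z * complex.Im w + complex.Im z * complex.Re w.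
Proof. by case: z w => ? ? [? ?]. Qed.

Lemma Re_addc (z w : R[i]) : complex.Re (z + w) = complex.Re z + complex.Re w.
Proof. by case: z w => ? ? [? ?]. Qed.

Lemma Im_addc (z w : R[i]) : complex.Im (z + w) = complex.Im z + complex.Im w.
Proof. by case: z w => ? ? [? ?]. Qed.

Lemma measurable_divr (a : R -> R) :
  measurable_fun Rplus a -> measurable_fun Rplus (fun r : R => a r / r).
Proof.
move=> ma; apply: measurable_funM => //.
apply: open_continuous_measurable_fun; first exact: interval_open.
by move=> x; rewrite inE RplusE => x0; apply: inv_continuous; rewrite gt_eqF.
Qed.

Definition wintegrable h : Prop :=
  mu.-integrable Rplus (EFin \o (fun r => complex.Re (h r) / r)) /\
  mu.-integrable Rplus (EFin \o (fun r => complex.Im (h r) / r)).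

Definition wint h : R[i] :=
  Complex (\int[mu]_(r in Rplus) (complex.Re (h r) / r))
          (\int[mu]_(r in Rplus) (complex.Im (h r) / r)).

Lemma wint_aeq h k : wintegrable h -> wintegrable k -> aeq h k -> wint h = wint k.
Proof.
move=> [h1 h2] [k1 k2] hk; rewrite /wint; congr Complex; rewrite /Rintegral;
  congr fine; apply: ae_eq_integral.
- exact: measurable_Rplus.
- by case/integrableP : h1.
- by case/integrableP : k1.
- by move: hk; apply: ae_imply => r H rR /=; rewrite H.
- exact: measurable_Rplus.
- by case/integrableP : h2.
- by case/integrableP : k2.
- by move: hk; apply: ae_imply => r H rR /=; rewrite H.
Qed.

Lemma wintD h k : wintegrable h -> wintegrable k ->
  wintegrable (fun r => h r + k r) /\
  wint (fun r => h r + k r) = wint h + wint k.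
Proof.
have mR := @measurable_Rplus R.
move=> [h1 h2] [k1 k2].
have E1 r : complex.Re (h r + k r) / r = complex.Re (h r) / r + complex.Re (k r) / r.
  by rewrite Re_addc mulrDl.
have E2 r : complex.Im (h r + k r) / r = complex.Im (h r) / r + complex.Im (k r) / r.
  by rewrite Im_addc mulrDl.
split.
  split; rewrite ?(funext E1) ?(funext E2).
    by have := integrableD mR h1 k1; apply: eq_integrable.
  by have := integrableD mR h2 k2; apply: eq_integrable.
by rewrite /wint (funext E1) (funext E2) !RintegralD.
Qed.

Lemma wintZ a h : wintegrable h ->
  wintegrable (fun r => a * h r) /\ wint (fun r => a * h r) = a * wint h.
Proof.
have mR := @measurable_Rplus R.
have IZ c (p : R -> R) : mu.-integrable Rplus (EFin \o p) ->
    mu.-integrable Rplus (EFin \o (fun r => c * p r)).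
  by move=> ip; have := integrableZl mR c ip; apply: eq_integrable.
move=> [h1 h2]; case: a => x y.
have E1 r : complex.Re (Complex x y * h r) / r =
    x * (complex.Re (h r) / r) + (- y) * (complex.Im (h r) / r).
  by rewrite Re_mulc /=; ring.
have E2 r : complex.Im (Complex x y * h r) / r =
    x * (complex.Im (h r) / r) + y * (complex.Re (h r) / r).
  by rewrite Im_mulc /=; ring.
split.
  split; rewrite ?(funext E1) ?(funext E2).
    by have := integrableD mR (IZ x _ h1) (IZ (- y) _ h2); apply: eq_integrable.
  by have := integrableD mR (IZ x _ h2) (IZ y _ h1); apply: eq_integrable.
rewrite /wint (funext E1) (funext E2) !RintegralD//; try exact: IZ.
rewrite !RintegralZl//.
by apply/eqP; rewrite eq_complex Re_mulc Im_mulc /= mulNr !eqxx.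
Qed.

Lemma wint_conj h : wintegrable h ->
  wintegrable (fun r => conjc (h r)) /\ wint (fun r => conjc (h r)) = conjc (wint h).
Proof.
have mR := @measurable_Rplus R.
move=> [h1 h2].
have E1 r : complex.Re (conjc (h r)) / r = complex.Re (h r) / r by case: (h r).
have E2 r : complex.Im (conjc (h r)) / r = -1 * (complex.Im (h r) / r).
  by case: (h r) => x y /=; ring.
split.
  split; rewrite ?(funext E1) ?(funext E2)//.
  by have := integrableZl mR (-1) h2; apply: eq_integrable.
by rewrite /wint (funext E1) (funext E2) RintegralZl//= mulN1r.
Qed.

Lemma measurable_normc2 f : measurable_fun Rplus (fun r => complex.Re (f r)) ->
  measurable_fun Rplus (fun r => complex.Im (f r)) ->
  measurable_fun Rplus (fun r : R => Normc.normc (f r) ^+ 2 / r).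
Proof.
move=> mf1 mf2; apply: measurable_divr; under eq_fun do rewrite normc2E.
by apply: measurable_funD; exact: measurable_funX.
Qed.

Lemma normc2_ge0 f r : 0 < r -> 0 <= Normc.normc (f r) ^+ 2 / r.
Proof. by move=> r0; rewrite divr_ge0 ?sqr_ge0// ltW. Qed.

Lemma isL2P f : isL2 f <-> [/\ measurable_fun Rplus (fun r => complex.Re (f r)),
      measurable_fun Rplus (fun r => complex.Im (f r)) &
      mu.-integrable Rplus (EFin \o (fun r => Normc.normc (f r) ^+ 2 / r))].
Proof.
have E : (\int[mu]_(r in Rplus) `|(EFin \o (fun r => (Normc.normc (f r) ^+ 2 / r)%R)) r| =
    \int[mu]_(r in Rplus) (Normc.normc (f r) ^+ 2 / r)%:E)%E.
  apply: eq_integral => r; rewrite inE RplusE => r0 /=.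
  by rewrite ger0_norm// normc2_ge0.
split=> -[m1 m2 If]; split=> //.
  apply/integrableP; split; first by apply/measurable_EFinP; exact: measurable_normc2.
  by rewrite E.
by move/integrableP : If => [_]; rewrite E.
Qed.

Lemma wintegrable_mulconj f g : isL2 f -> isL2 g ->
  wintegrable (fun r => f r * conjc (g r)).
Proof.
move=> /isL2P[f1 f2 If] /isL2P[g1 g2 Ig].
have mR := @measurable_Rplus R.
have dom (p : R -> R) : measurable_fun Rplus p ->
    (forall r, `|p r| <= Normc.normc (f r) ^+ 2 + Normc.normc (g r) ^+ 2) ->
    mu.-integrable Rplus (EFin \o (fun r => p r / r)).
  move=> mp pfg.
  apply: le_integrable (integrableD mR If Ig) => //.
    by apply/measurable_EFinP; exact: measurable_divr.
  move=> r; rewrite RplusE => r0; rewrite lee_fin -mulrDl normrM.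
  rewrite (ger0_norm (_ : 0 <= (_ + _) / r)); last first.
    by rewrite divr_ge0 ?addr_ge0 ?sqr_ge0// ltW.
  rewrite normfV [`|r|]gtr0_norm// ler_pM2r ?invr_gt0//.
have bound (a b c d : R) : `|a * c + b * d| <= a ^+ 2 + b ^+ 2 + (c ^+ 2 + d ^+ 2).
  have h1 := sqr_ge0 (a + c); have h2 := sqr_ge0 (b + d).
  have h3 := sqr_ge0 (a - c); have h4 := sqr_ge0 (b - d).
  rewrite sqrrD in h1; rewrite sqrrD in h2; rewrite sqrrB in h3; rewrite sqrrB in h4.
  have [] := (sqr_ge0 a, sqr_ge0 b, sqr_ge0 c, sqr_ge0 d) => -[[a2 b2] c2] d2.
  by rewrite ler_norml; apply/andP; split; lra.
split; apply: dom.
- under eq_fun do rewrite Re_mulconj.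
  by apply: measurable_funD; apply: measurable_funM.
- move=> r; rewrite Re_mulconj !normc2E.
  exact: bound.
- under eq_fun do rewrite Im_mulconj.
  by apply: measurable_funB; apply: measurable_funM.
- move=> r; rewrite Im_mulconj !normc2E.
  have := bound (complex.Im (f r)) (- complex.Re (f r)) (complex.Re (g r)) (complex.Im (g r)).
  by rewrite mulNr sqrrN [complex.Im _ ^+ 2 + complex.Re _ ^+ 2]addrC.
Qed.

End WeightedIntegral.

(** * The inner product *)

Section InnerProduct.
Variable R : realType.
Implicit Types (a : R[i]) (u v w : L2 R).
Local Notation mu := (@lebesgue_measure R).
Local Notation "<< u , v >>" := (L2inner u v).
Local Notation "N[ u ]" := (L2norm u).
Local Notation Re := complex.Re.
Local Notation Im := complex.Im.

Lemma conjcD (a b : R[i]) : conjc (a + b) = conjc a + conjc b.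
Proof. exact: rmorphD. Qed.

Lemma conjcM (a b : R[i]) : conjc (a * b) = conjc a * conjc b.
Proof. exact: rmorphM. Qed.

Lemma L2innerE u v : L2inner u v = wint (fun r => L2repr u r * conjc (L2repr v r)).
Proof. by []. Qed.

Lemma wintegrable_inner u v :
  wintegrable (fun r => L2repr u r * conjc (L2repr v r)).
Proof. by apply: wintegrable_mulconj; exact: isL2_repr. Qed.

Lemma L2innerDl u v w : << u + v, w >> = << u, w >> + << v, w >>.
Proof.
have [I1 E1] := wintD (wintegrable_inner u w) (wintegrable_inner v w).
rewrite [RHS]/(_ + _) -[RHS]E1 L2innerE; apply: wint_aeq => //.
  exact: wintegrable_inner.
by apply: ae_imply (L2reprD u v) => r h r0; rewrite h// mulrDl.
Qed.

Lemma L2innerZl a u w : << a *: u, w >> = a * << u, w >>.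
Proof.
have [I1 E1] := wintZ a (wintegrable_inner u w).
rewrite [RHS]/(_ * _) -[RHS]E1 L2innerE; apply: wint_aeq => //.
  exact: wintegrable_inner.
by apply: ae_imply (L2reprZ a u) => r h r0; rewrite h// mulrA.
Qed.

Lemma L2inner_conj u v : conjc << u, v >> = << v, u >>.
Proof.
have [I1 E1] := wint_conj (wintegrable_inner u v).
rewrite [LHS]/(conjc _) -[LHS]E1 [RHS]L2innerE; congr wint; apply/funext => r.
by rewrite conjcM conjcK mulrC.
Qed.

Lemma L2norm_ge0 u : 0 <= N[u].
Proof. exact: sqrtr_ge0. Qed.

Lemma L2norm2E u : N[u] ^+ 2 = \int[mu]_(r in Rplus) (Normc.normc (L2repr u r) ^+ 2 / r).
Proof.
rewrite sqr_sqrtr//; apply: Rintegral_ge0 => r; rewrite RplusE; exact: normc2_ge0.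
Qed.

Lemma L2inner_self u : << u, u >> = (N[u] ^+ 2)%:C.
Proof.
rewrite L2norm2E; apply/eqP; rewrite eq_complex/=; apply/andP; split; apply/eqP.
  by apply: eq_Rintegral => r _; rewrite Re_mulconj normc2E -!expr2.
rewrite (_ : (fun r => _) = fun=> 0).
  by rewrite Rintegral_cst ?mul0r//; exact: measurable_Rplus.
by apply/funext => r; rewrite Im_mulconj [X in X - _]mulrC subrr mul0r.
Qed.

Lemma L2norm2 u : N[u] ^+ 2 = Re << u, u >>.
Proof. by rewrite L2inner_self. Qed.

Lemma L2norm_eq0 u : N[u] = 0 -> u = 0.
Proof.
move=> /(congr1 (fun x => x ^+ 2)); rewrite expr0n/= L2norm2E => I0.
have /isL2P[m1 m2 Iu] := isL2_repr u.
apply: L2_eq; apply: aeq_trans (aeq_sym (L2repr0 R)).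
have : ae_eq mu Rplus (EFin \o (fun r => Normc.normc (L2repr u r) ^+ 2 / r)) (cst 0%E).
  apply/ae_eq_integral_abs.
  - exact: measurable_Rplus.
  - by case/integrableP : Iu.
  - transitivity (\int[mu]_(r in Rplus) (Normc.normc (L2repr u r) ^+ 2 / r)%:E)%E.
      apply: eq_integral => r; rewrite inE RplusE => r0 /=.
      by rewrite ger0_norm// normc2_ge0.
    rewrite -[LHS]fineK; first by move: I0; rewrite /Rintegral => ->.
    by apply: integrable_fin_num => //; exact: measurable_Rplus.
apply: ae_imply => r h rR; have := h rR; move: rR; rewrite RplusE => r0 /= [] /eqP.
rewrite mulf_eq0 invr_eq0 [r == 0]gt_eqF// orbF expf_eq0/= => /eqP h0.
exact: Normc.eq0_normc.
Qed.

Lemma L2innerDr u v w : << u, v + w >> = << u, v >> + << u, w >>.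
Proof. by rewrite -L2inner_conj L2innerDl conjcD !L2inner_conj. Qed.

Lemma L2innerZr a u w : << u, a *: w >> = conjc a * << u, w >>.
Proof. by rewrite -L2inner_conj L2innerZl conjcM L2inner_conj. Qed.

Lemma L2innerBl u v w : << u - v, w >> = << u, w >> - << v, w >>.
Proof. by rewrite L2innerDl -scaleN1r L2innerZl mulN1r. Qed.

Lemma L2innerBr u v w : << u, v - w >> = << u, v >> - << u, w >>.
Proof. by rewrite L2innerDr -scaleN1r L2innerZr (_ : conjc (-1) = -1) ?mulN1r// /conjc/= oppr0. Qed.

Lemma L2inner0l u : << 0, u >> = 0.
Proof. by rewrite -(scale0r (0 : L2 R)) L2innerZl mul0r. Qed.

Lemma L2inner0r u : << u, 0 >> = 0.
Proof. by rewrite -L2inner_conj L2inner0l /conjc/= oppr0. Qed.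

Lemma L2inner_suml n (U : nat -> L2 R) w :
  << \sum_(k < n) U k, w >> = \sum_(k < n) << U k, w >>.
Proof.
elim: n => [|n IH]; first by rewrite !big_ord0 L2inner0l.
by rewrite !big_ord_recr/= L2innerDl IH.
Qed.

Lemma L2norm0 : N[0 : L2 R] = 0.
Proof. by apply/eqP; rewrite -sqrf_eq0 L2norm2 L2inner0l. Qed.

Lemma normc_conj a : Normc.normc (conjc a) = Normc.normc a.
Proof. by case: a => x y /=; rewrite sqrrN. Qed.

Lemma mulc_conj a : a * conjc a = (Normc.normc a ^+ 2)%:C.
Proof.
apply/eqP; rewrite eq_complex Re_mulconj Im_mulconj normc2E/= -!expr2 eqxx/=.
by rewrite mulrC subrr.
Qed.

Lemma normc_ge0 a : 0 <= Normc.normc a.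
Proof. by case: a => x y /=; exact: sqrtr_ge0. Qed.

Lemma normcN a : Normc.normc (- a) = Normc.normc a.
Proof. by case: a => x y /=; rewrite !sqrrN. Qed.

Lemma normcR (x : R) : Normc.normc x%:C = `|x|.
Proof. by rewrite /= expr0n/= addr0 sqrtr_sqr. Qed.

Lemma normc0 : Normc.normc (0 : R[i]) = 0.
Proof. by rewrite /= expr0n/= addr0 sqrtr0. Qed.

Lemma L2normZ a u : N[a *: u] = Normc.normc a * N[u].
Proof.
apply/eqP; rewrite -(@eqrXn2 _ 2)// ?mulr_ge0 ?L2norm_ge0 ?normc_ge0//.
rewrite L2norm2 L2innerZl L2innerZr mulrA mulc_conj L2inner_self.
by rewrite Re_mulc/= mulr0 subr0 exprMn.
Qed.

Lemma L2normN u : N[- u] = N[u].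
Proof.
by rewrite -scaleN1r L2normZ normcN /= expr1n expr0n/= addr0 sqrtr1 mul1r.
Qed.

Lemma L2normBC u v : N[u - v] = N[v - u].
Proof. by rewrite -L2normN opprB. Qed.

Lemma L2norm_sqrB u v : N[u - v] ^+ 2 = N[u] ^+ 2 + N[v] ^+ 2 - 2 * Re << u, v >>.
Proof.
rewrite !L2norm2 L2innerBl !L2innerBr -[<< v, u >>]L2inner_conj.
case: << u, u >> << u, v >> << v, v >> => a1 a2 [b1 b2] [c1 c2] /=; ring.
Qed.

Lemma L2_CauchySchwarz u v : Normc.normc << u, v >> <= N[u] * N[v].
Proof.
have [v0|v0] := eqVneq (N[v]) 0.
  by rewrite (L2norm_eq0 v0) L2inner0r normc0 L2norm0 mulr0.
rewrite -(@ler_sqr _ _ _) ?nnegrE ?mulr_ge0 ?L2norm_ge0 ?normc_ge0//.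
have := sqr_ge0 (N[(N[v] ^+ 2)%:C *: u - << u, v >> *: v]).
rewrite L2norm_sqrB !L2normZ L2innerZl L2innerZr.
have -> : Re ((N[v] ^+ 2)%:C * (conjc << u, v >> * << u, v >>)) =
    N[v] ^+ 2 * Normc.normc << u, v >> ^+ 2.
  by rewrite [conjc _ * _]mulrC mulc_conj Re_mulc/= mulr0 subr0.
rewrite normcR ger0_norm ?sqr_ge0// => h.
have v2 : 0 < N[v] ^+ 2 by rewrite exprn_even_gt0.
rewrite -(ler_pM2l v2) -subr_ge0; apply: le_trans h _; rewrite le_eqVlt; apply/orP; left.
by apply/eqP; ring.
Qed.

Lemma Re_le_normc a : Re a <= Normc.normc a.
Proof.
case: a => x y /=; apply: (le_trans (ler_norm _)).
by rewrite -sqrtr_sqr ler_wsqrtr// lerDl sqr_ge0.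
Qed.

Lemma L2norm_triangle u v : N[u + v] <= N[u] + N[v].
Proof.
rewrite -(@ler_sqr _ _ _) ?nnegrE ?addr_ge0 ?L2norm_ge0//.
rewrite -[v]opprK L2norm_sqrB !L2normN.
have h1 := L2_CauchySchwarz u (- v).
have h2 := Re_le_normc (- << u, - v >>).
have h3 : Re (- << u, - v >>) = - Re << u, - v >> by case: << u, - v >>.
rewrite h3 normcN in h2; rewrite L2normN in h1.
rewrite sqrrD; lra.
Qed.

Lemma L2norm_triangleB u v w : N[u - w] <= N[u - v] + N[v - w].
Proof. by have := L2norm_triangle (u - v) (v - w); rewrite subrKA. Qed.

Lemma L2norm_sum n m (U : nat -> L2 R) :
  N[\sum_(n <= k < m) U k] <= \sum_(n <= k < m) N[U k].
Proof.
elim/big_ind2 : _ => //; first by rewrite L2norm0.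
by move=> x1 x2 y1 y2 h1 h2; apply: (le_trans (L2norm_triangle _ _)); exact: lerD.
Qed.

End InnerProduct.

(** * Completeness *)

Section Completeness.
Variable R : realType.
Implicit Types (f g : R -> R[i]) (u v x : L2 R).
Local Notation mu := (@lebesgue_measure R).
Local Notation "N[ u ]" := (L2norm u).
Local Notation Re := complex.Re.
Local Notation Im := complex.Im.

(** The upper limit is measurable and defined everywhere, whereas the limit only
    makes sense at the points of convergence. *)
Lemma measurable_pointwise_lim (p : nat -> R -> R) :
  (forall n, measurable_fun Rplus (p n)) ->
  exists2 h : R -> R, measurable_fun Rplus h &
    forall r, cvgn (p ^~ r) -> p n r @[n --> \oo] --> h r.
Proof.
move=> mp; exists (fun r => fine (limn_esup (fun n => (p n r)%:E))).
  have mf : measurable_fun setT (@fine R) by exact: fine_measurable.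
  apply: (measurableT_comp mf); apply: measurable_fun_limn_esup => n.
  by apply/measurable_EFinP.
move=> r pr.
have h : (p n r)%:E @[n --> \oo] --> (limn (p ^~ r))%:E.
  by apply: cvg_EFin => //; exact: nearW.
by rewrite (cvg_limn_einf_sup h).
Qed.

Lemma limn_einf_le (a : (\bar R)^nat) (c : \bar R) :
  (forall n, (a n <= c)%E) -> (limn_einf a <= c)%E.
Proof.
move=> ac; rewrite limn_einf_lim; apply: lime_le; first exact: is_cvg_einfs.
apply: nearW => n; apply: le_trans (ac n).
by apply: ereal_inf_lbound; exists n => /=.
Qed.

Lemma isL2B f g : isL2 f -> isL2 g -> isL2 (fun r => f r - g r).
Proof. move=> /asboolP f2 /asboolP g2; apply/asboolP.
exact: (@rpredB _ (@L2pred R) f g f2 g2). Qed.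

Lemma isL2D f g : isL2 f -> isL2 g -> isL2 (fun r => f r + g r).
Proof. move=> /asboolP f2 /asboolP g2; apply/asboolP.
exact: (@rpredD _ (@L2pred R) f g f2 g2). Qed.

Lemma L2norm2_aeq u f : isL2 f -> aeq (L2repr u) f ->
  (N[u] ^+ 2)%:E = (\int[mu]_(r in Rplus) (Normc.normc (f r) ^+ 2 / r)%:E)%E.
Proof.
move=> /isL2P[f1 f2 If] uf; have /isL2P[u1 u2 Iu] := isL2_repr u.
rewrite L2norm2E /Rintegral fineK; last first.
  by apply: integrable_fin_num => //; exact: measurable_Rplus.
apply: ae_eq_integral.
- exact: measurable_Rplus.
- by case/integrableP : Iu.
- by case/integrableP : If.
- by apply: ae_imply uf => r h rR; rewrite h.
Qed.

(** Fatou's lemma, applied to [|P m - P n|^2] as [m] grows, bounds the distance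
    from [P n] to the pointwise limit. *)
Lemma ae_cvg_L2 (P : nat -> L2 R) (c : nat -> R) :
  (forall n m, (n <= m)%N -> N[P m - P n] <= c n) ->
  {ae mu, forall r, Rplus r -> cvgn (fun n => Re (L2repr (P n) r)) /\
                               cvgn (fun n => Im (L2repr (P n) r))} ->
  exists x, forall n, N[x - P n] <= c n.
Proof.
move=> Pc Pae.
have c0 n : 0 <= c n by apply: le_trans (Pc n n (leqnn _)); exact: L2norm_ge0.
have mRe n : measurable_fun Rplus (fun r => Re (L2repr (P n) r)).
  by have [] := isL2_repr (P n).
have mIm n : measurable_fun Rplus (fun r => Im (L2repr (P n) r)).
  by have [] := isL2_repr (P n).
have [hr mhr Hr] := measurable_pointwise_lim mRe.
have [hi mhi Hi] := measurable_pointwise_lim mIm.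
pose f r := Complex (hr r) (hi r).
pose d n r := f r - L2repr (P n) r.
have dRe n r : Re (d n r) = hr r - Re (L2repr (P n) r).
  by rewrite /d /f; case: (L2repr (P n) r).
have dIm n r : Im (d n r) = hi r - Im (L2repr (P n) r).
  by rewrite /d /f; case: (L2repr (P n) r).
have m1 n : measurable_fun Rplus (fun r => Re (d n r)).
  by under eq_fun do rewrite dRe; exact: measurable_funB.
have m2 n : measurable_fun Rplus (fun r => Im (d n r)).
  by under eq_fun do rewrite dIm; exact: measurable_funB.
pose W n m r : \bar R := (Normc.normc (L2repr (P (m + n)%N) r - L2repr (P n) r) ^+ 2 / r)%:E.
have W2 n m : isL2 (fun r => L2repr (P (m + n)%N) r - L2repr (P n) r).
  by apply: isL2B; exact: isL2_repr.
have mW n m : measurable_fun Rplus (W n m).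
  by have [w1 w2 _] := W2 n m; apply/measurable_EFinP; exact: measurable_normc2.
have W0 n m r : Rplus r -> (0 <= W n m r)%E.
  by rewrite RplusE => r0; rewrite lee_fin; apply: (normc2_ge0 (fun=> _)).
have mR := @measurable_Rplus R.
have meinf n : measurable_fun Rplus (fun r => limn_einf (fun m => W n m r)).
  under eq_fun do rewrite -[limn_einf _]oppeK -limn_esupN.
  apply: measurableT_comp => //; apply: measurable_fun_limn_esup => m.
  by apply: measurableT_comp.
have Wle n m : (\int[mu]_(r in Rplus) W n m r <= (c n ^+ 2)%:E)%E.
  rewrite -(@L2norm2_aeq (P (m + n)%N - P n))//; last exact: L2reprB.
  by rewrite lee_fin ler_sqr ?nnegrE ?L2norm_ge0// Pc// leq_addl.
have dle n : (\int[mu]_(r in Rplus) (Normc.normc (d n r) ^+ 2 / r)%:E <= (c n ^+ 2)%:E)%E.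
  have := @fatou _ _ R mu _ mR _ (mW n) (W0 n).
  move/le_trans => /(_ (c n ^+ 2)%:E); rewrite limn_einf_le// => /(_ isT).
  apply: le_trans; apply: ae_ge0_le_integral => //.
  - by move=> r; rewrite RplusE lee_fin => r0; exact: normc2_ge0.
  - by apply/measurable_EFinP; exact: measurable_normc2.
  - move=> r rR; rewrite limn_einf_lim; apply: lime_ge; first exact: is_cvg_einfs.
    apply: nearW => m; apply: le_ereal_inf_tmp => _ [k _ <-]; exact: W0.
  - exact: meinf.
  apply: ae_imply Pae => r /[apply] -[c1 c2].
  have {}c1 := Hr r c1; have {}c2 := Hi r c2.
  suff /cvg_limn_einf_sup[-> _] : W n m r @[m --> \oo] --> (Normc.normc (d n r) ^+ 2 / r)%:E.
    exact: lexx.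
  apply: cvg_EFin; first exact: nearW.
  have E : fine \o (W n)^~ r = fun m =>
      ((Re (L2repr (P (m + n)%N) r) - Re (L2repr (P n) r)) ^+ 2 +
       (Im (L2repr (P (m + n)%N) r) - Im (L2repr (P n) r)) ^+ 2) / r.
    apply/funext => m; rewrite /W/= normc2E.
    by case: (L2repr (P (m + n)%N) r) => ? ?; case: (L2repr (P n) r).
  rewrite E normc2E dRe dIm.
  have sq (a : nat -> R) (l b : R) : a @ \oo --> l ->
      (a m - b) ^+ 2 @[m --> \oo] --> (l - b) ^+ 2.
    move=> al; have h : a m - b @[m --> \oo] --> l - b.
      by apply: cvgB; [exact: al | exact: cvg_cst].
    exact: (cvgM h h).
  have {}c1 : Re (L2repr (P (m + n)%N) r) @[m --> \oo] --> hr r.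
    by rewrite (cvg_shiftn n (fun m => Re (L2repr (P m) r))).
  have {}c2 : Im (L2repr (P (m + n)%N) r) @[m --> \oo] --> hi r.
    by rewrite (cvg_shiftn n (fun m => Im (L2repr (P m) r))).
  apply: cvgM; last exact: cvg_cst.
  apply: cvgD.
    exact: (sq (fun m => Re (L2repr (P (m + n)%N) r))).
  exact: (sq (fun m => Im (L2repr (P (m + n)%N) r))).
have d2 n : isL2 (d n).
  by split => //; apply: le_lt_trans (dle n) _; rewrite ltry.
have f2 : isL2 f.
  have -> : f = fun r => d 0%N r + L2repr (P 0%N) r by apply/funext => r; rewrite subrK.
  by apply: isL2D => //; exact: isL2_repr.
exists (toL2 f) => n.
rewrite -(@ler_sqr _ _ _) ?nnegrE ?L2norm_ge0// -lee_fin.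
rewrite (@L2norm2_aeq _ (d n))//.
by apply: ae_imply2 (L2reprB (toL2 f) (P n)) (L2repr_toL2 f2) => r h1 h2 r0; rewrite h1// h2.
Qed.

End Completeness.

Section SummableSeries.
Variable R : realType.
Implicit Types (u : nat -> L2 R).
Local Notation mu := (@lebesgue_measure R).
Local Notation "N[ u ]" := (L2norm u).
Local Notation Re := complex.Re.
Local Notation Im := complex.Im.

Lemma nneseries_cvgn (a : nat -> R) : (forall n, 0 <= a n) ->
  (\sum_(0 <= n <oo) (a n)%:E < +oo)%E -> cvgn (series a).
Proof.
move=> a0 afin; apply: nondecreasing_is_cvgn.
  by apply/nondecreasing_seqP => n; rewrite /series/= big_nat_recr//= lerDl.
exists (fine (\sum_(0 <= n <oo) (a n)%:E)) => _ [n _ <-].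
rewrite -lee_fin fineK; last first.
  by rewrite ge0_fin_numE// nneseries_ge0// => k _ _; rewrite lee_fin.
rewrite /series/= -sumEFin; apply: nneseries_lim_ge => k _ _.
by rewrite lee_fin.
Qed.

Lemma nneseries_limn (a : nat -> R) : cvgn (series a) ->
  (\sum_(0 <= n <oo) (a n)%:E = (limn (series a))%:E)%E.
Proof.
move=> ca; apply/cvg_lim => //.
under eq_fun do rewrite sumEFin.
by apply: cvg_EFin; [exact: nearW | exact: ca].
Qed.

Lemma le_series_limn (a : nat -> R) n m : (forall n, 0 <= a n) -> cvgn (series a) ->
  (n <= m)%N -> \sum_(n <= k < m) a k <= limn (series a) - series a n.
Proof.
move=> a0 ca nm; rewrite lerBrDl /series/= -(big_cat_nat (leq0n n) nm)//=.
rewrite -[leLHS]/(series a m); apply: nondecreasing_cvgn_le => //.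
by apply/nondecreasing_seqP => k; rewrite /series/= big_nat_recr//= lerDl.
Qed.

Lemma series_tail_cvg0 (a : nat -> R) : cvgn (series a) ->
  limn (series a) - series a n @[n --> \oo] --> (0 : R).
Proof.
move=> ca; rewrite -(subrr (limn (series a))).
by apply: cvgB; [exact: cvg_cst | exact: ca].
Qed.

Lemma abs_Re_le (z : R[i]) : `|Re z| <= Normc.normc z.
Proof. by case: z => x y /=; rewrite -sqrtr_sqr ler_wsqrtr// lerDl sqr_ge0. Qed.

Lemma abs_Im_le (z : R[i]) : `|Im z| <= Normc.normc z.
Proof. by case: z => x y /=; rewrite -sqrtr_sqr ler_wsqrtr// lerDr sqr_ge0. Qed.

(** By the arithmetic-geometric inequality [|u_n| <= |u_n|^2 / w_n + w_n]
    pointwise, and the integrals of [|u_n|^2 / w_n] are at most [w_n], hence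
    summable. *)
Lemma ae_cvg_summable u (w : nat -> R) :
  (forall n, 0 < w n) -> (forall n, N[u n] <= w n) -> cvgn (series w) ->
  {ae mu, forall r, Rplus r -> cvgn (series (fun n => Re (L2repr (u n) r))) /\
                               cvgn (series (fun n => Im (L2repr (u n) r)))}.
Proof.
move=> w0 uw cw; have mR := @measurable_Rplus R.
pose b n r := (w n)^-1 * (Normc.normc (L2repr (u n) r) ^+ 2 / r).
have I2 n : mu.-integrable Rplus (EFin \o (fun r => Normc.normc (L2repr (u n) r) ^+ 2 / r)).
  by have /isL2P[] := isL2_repr (u n).
have Ib n : mu.-integrable Rplus (EFin \o b n).
  by have := integrableZl mR (w n)^-1 (I2 n); apply: eq_integrable.
have mb n : measurable_fun Rplus (EFin \o b n) by case/integrableP : (Ib n).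
have b0 n r : 0 < r -> 0 <= b n r.
  by move=> r0; rewrite mulr_ge0 ?invr_ge0 ?(ltW (w0 n))//; exact: normc2_ge0.
have bint n : (\int[mu]_(r in Rplus) (b n r)%:E <= (w n)%:E)%E.
  rewrite (@eq_integral _ _ _ mu _ (fun r => (w n)^-1%:E *
    (Normc.normc (L2repr (u n) r) ^+ 2 / r)%:E)%E); last by [].
  rewrite ge0_integralZl_EFin//; first last.
  - by rewrite invr_ge0 ltW.
  - by case/integrableP : (I2 n).
  - by move=> r; rewrite RplusE lee_fin => r0; exact: normc2_ge0.
  rewrite -(@L2norm2_aeq _ (u n))//; last exact: ae_eq_refl.
    rewrite -EFinM lee_fin mulrC ler_pdivrMr// -expr2 ler_sqr ?nnegrE ?L2norm_ge0//.
    exact: ltW.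
  exact: isL2_repr.
pose G r := (\sum_(0 <= n <oo) (b n r)%:E)%E.
have G0 r : 0 < r -> (0 <= G r)%E.
  by move=> r0; apply: nneseries_ge0 => n _ _; rewrite lee_fin b0.
have IG : mu.-integrable Rplus G.
  apply/integrableP; split.
    apply: ge0_emeasurable_sum => n; last by move=> _; exact: mb.
    by move=> r; rewrite RplusE lee_fin => r0 _; exact: b0.
  rewrite (@eq_integral _ _ _ mu _ G); last first.
    by move=> r; rewrite inE RplusE => r0; rewrite gee0_abs ?G0.
  rewrite integral_nneseries//; last first.
    by move=> n r; rewrite RplusE lee_fin => r0; exact: b0.
  apply: (@le_lt_trans _ _ (\sum_(0 <= n <oo) (w n)%:E)%E).
    apply: lee_nneseries => [n _ _|n _]; last exact: bint.
    by apply: integral_ge0 => r; rewrite RplusE lee_fin => r0; exact: b0.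
  by rewrite nneseries_limn// ltry.
have := integrable_ae mR IG; apply: ae_imply => r H rR.
have {H} := H rR; rewrite RplusE in rR.
rewrite ge0_fin_numE ?G0// => /nneseries_cvgn cb.
have {}cb : cvgn (series (b ^~ r)) by apply: cb => n; exact: b0.
pose c n := r * b n r + w n.
have cc : cvgn (series c).
  have -> : series c = fun n => r * series (b ^~ r) n + series w n.
    by apply/funext => n; rewrite /series/= mulr_sumr -big_split.
  by apply: is_cvgD => //; apply: is_cvgM => //; exact: is_cvg_cst.
have uc n : Normc.normc (L2repr (u n) r) <= c n.
  have r1 : r != 0 by rewrite gt_eqF.
  have y0 := w0 n; have y1 : w n != 0 by rewrite gt_eqF.
  have -> : c n = Normc.normc (L2repr (u n) r) ^+ 2 / w n + w n.
    by rewrite /c /b; move: (Normc.normc _) => x; field; rewrite r1 y1.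
  move: (Normc.normc _) (w n) y0 y1 => x y y0 y1.
  rewrite -(ler_pM2l y0) mulrDr mulrCA mulfV// mulr1 -subr_ge0.
  have -> : x ^+ 2 + y * y - y * x = (x - y / 2) ^+ 2 + 3 / 4 * y ^+ 2 by field.
  by apply: addr_ge0; [exact: sqr_ge0 | apply: mulr_ge0; rewrite ?sqr_ge0 ?divr_ge0].
have c0 n : 0 <= c n.
  by apply: addr_ge0; [apply: mulr_ge0; [exact: ltW | exact: b0] | exact: ltW].
split; apply: normed_cvg; apply: series_le_cvg c0 _ cc => n /=; rewrite ?normr_ge0//.
  exact: le_trans (abs_Re_le _) (uc n).
exact: le_trans (abs_Im_le _) (uc n).
Qed.

(** Absolute convergence in norm gives convergence almost everywhere, by
    [ae_cvg_summable], and then the sum is the pointwise limit; this is the form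
    in which completeness enters. *)
Lemma L2_summable u (w : nat -> R) :
  (forall n, N[u n] <= w n) -> cvgn (series w) ->
  exists x, forall n, N[x - \sum_(k < n) u k] <= limn (series w) - series w n.
Proof.
move=> uw cw; have w0 n : 0 <= w n by apply: le_trans (uw n); exact: L2norm_ge0.
pose P n := \sum_(k < n) u k.
apply: (@ae_cvg_L2 R P).
  move=> n m nm; rewrite /P -!(big_mkord xpredT u) (big_cat_nat (leq0n n) nm)//= addrC addrK.
  apply: (le_trans (L2norm_sum _ _ _)); apply: le_trans (le_series_limn w0 cw nm).
  by apply: ler_sum_nat => k _; exact: uw.
(* The weights are divided by, hence the summable positive correction. *)
pose w' n := w n + geometric 1 2^-1 n.
have w'0 n : 0 < w' n by rewrite /w' ltr_wpDl//= mul1r exprn_gt0.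
have uw' n : N[u n] <= w' n.
  by apply: le_trans (uw n) _; rewrite lerDl/= mul1r exprn_ge0.
have cw' : cvgn (series w').
  have -> : series w' = fun n => series w n + series (geometric 1 2^-1) n.
    by apply/funext => n; rewrite /series/= -big_split.
  apply: is_cvgD => //; apply: is_cvg_geometric_series.
  by rewrite ger0_norm// invf_lt1// ltr1n.
have h1 := ae_cvg_summable w'0 uw' cw'.
have h2 := ae_foralln (fun n => L2repr_sum n u).
apply: ae_imply2 h1 h2 => r H1 H2 rR.
have [c1 c2] := H1 rR.
have E n : L2repr (P n) r = \sum_(k < n) L2repr (u k) r by exact: H2.
have E1 : (fun n => Re (L2repr (P n) r)) = series (fun n => Re (L2repr (u n) r)).
  apply/funext => n; rewrite E /series/= big_mkord.
  by elim/big_ind2 : _ => // x1 x2 y1 y2 <- <-; rewrite Re_addc.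
have E2 : (fun n => Im (L2repr (P n) r)) = series (fun n => Im (L2repr (u n) r)).
  apply/funext => n; rewrite E /series/= big_mkord.
  by elim/big_ind2 : _ => // x1 x2 y1 y2 <- <-; rewrite Im_addc.
by rewrite E1 E2.
Qed.

End SummableSeries.

(** * Norm limits *)

Section Limits.
Variable R : realType.
Implicit Types (P Q : nat -> L2 R) (u v x y : L2 R) (a : R[i]).
Local Notation "N[ u ]" := (L2norm u).
Local Notation "<< u , v >>" := (L2inner u v).

Lemma conjcB (a b : R[i]) : conjc (a - b) = conjc a - conjc b.
Proof. exact: rmorphB. Qed.

Lemma ler_normcD (a b : R[i]) :
  Normc.normc (a + b) <= Normc.normc a + Normc.normc b.
Proof. exact: (@le_normcD R a b). Qed.

Definition L2cvg P x : Prop := N[x - P n] @[n --> \oo] --> (0 : R).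

Lemma L2cvg_squeeze P x (c : nat -> R) : c @ \oo --> (0 : R) ->
  (forall n, N[x - P n] <= c n) -> L2cvg P x.
Proof.
move=> c0 Pc; apply: (squeeze_cvgr _ (cvg_cst 0) c0).
by apply: nearW => n; rewrite L2norm_ge0 Pc.
Qed.

Lemma cvg0_le (c : nat -> R) (b : R) : c @ \oo --> (0 : R) ->
  (forall n, b <= c n) -> b <= 0.
Proof.
move=> c0 bc; rewrite -(cvg_lim (@norm_hausdorff _ R) c0).
by apply: limr_ge; [apply/cvg_ex; exists 0 | exact: nearW].
Qed.

Lemma L2cvg_unique P x y : L2cvg P x -> L2cvg P y -> x = y.
Proof.
move=> Px Py; apply/eqP; rewrite -subr_eq0; apply/eqP/L2norm_eq0.
apply/eqP; rewrite eq_le L2norm_ge0 andbT.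
have h : N[x - P n] + N[y - P n] @[n --> \oo] --> (0 : R).
  by rewrite -[X in _ --> X](addr0 0); exact: cvgD Px Py.
apply: (cvg0_le h) => n.
by rewrite [N[y - _]]L2normBC; exact: L2norm_triangleB.
Qed.

Lemma L2cvgD P Q x y : L2cvg P x -> L2cvg Q y -> L2cvg (fun n => P n + Q n) (x + y).
Proof.
move=> Px Qy; have h : N[x - P n] + N[y - Q n] @[n --> \oo] --> (0 : R).
  by rewrite -[X in _ --> X](addr0 0); exact: cvgD Px Qy.
apply: (L2cvg_squeeze h) => n.
by rewrite opprD addrACA; exact: L2norm_triangle.
Qed.

Lemma L2cvgZ a P x : L2cvg P x -> L2cvg (fun n => a *: P n) (a *: x).
Proof.
move=> Px.
have h : Normc.normc a * N[x - P n] @[n --> \oo] --> (0 : R).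
  by rewrite -[X in _ --> X](mulr0 (Normc.normc a)); apply: cvgM; [exact: cvg_cst | exact: Px].
by apply: (L2cvg_squeeze h) => n; rewrite -scalerBr L2normZ.
Qed.

Lemma L2cvg_inner P x v : L2cvg P x ->
  Normc.normc (<< x, v >> - << P n, v >>) @[n --> \oo] --> (0 : R).
Proof.
move=> Px.
have h : N[x - P n] * N[v] @[n --> \oo] --> (0 : R).
  by rewrite -[X in _ --> X](mul0r N[v]); apply: cvgM; [exact: Px | exact: cvg_cst].
apply: (squeeze_cvgr _ (cvg_cst 0) h); apply: nearW => n.
by rewrite normc_ge0 -L2innerBl L2_CauchySchwarz.
Qed.

End Limits.

(** * Norm-convergent sums of rank-one operators *)

Section DiagonalOperators.
Variable R : realType.
Variables (s : nat -> R).
Hypothesis s_ge0 : forall n, 0 <= s n.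
Hypothesis s_summable : cvgn (series s).
Implicit Types (f g : nat -> L2 R) (u v x : L2 R) (a : R[i]) (A : L2 R -> L2 R).
Local Notation "N[ u ]" := (L2norm u).
Local Notation "<< u , v >>" := (L2inner u v).
Local Notation Re := complex.Re.
Local Notation tail n := (limn (series s) - series s n).

Definition diag_sum f g n u : L2 R :=
  \sum_(k < n) (s k)%:C *: rank_one (g k) (f k) u.

Lemma diag_sumZD f g n a u v :
  diag_sum f g n (a *: u + v) = a *: diag_sum f g n u + diag_sum f g n v.
Proof.
rewrite /diag_sum scaler_sumr -big_split/=; apply: eq_bigr => k _.
by rewrite /rank_one L2innerDl L2innerZl scalerDl scalerDr !scalerA !mulrA [_ * a]mulrC.
Qed.

Lemma diag_sum_inner f g n u v :
  << diag_sum f g n u, v >> = \sum_(k < n) (s k)%:C * (<< u, f k >> * << g k, v >>).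
Proof.
rewrite /diag_sum (L2inner_suml n (fun k => (s k)%:C *: rank_one (g k) (f k) u)).
apply: eq_bigr => k _.
by rewrite L2innerZl /rank_one L2innerZl.
Qed.

(** The explicit rate, uniform on bounded sets, gives both the convergence in
    operator norm and, for [n = 0], the bound on [A]. *)
Definition is_diag_op f g (C : R) A : Prop := 0 <= C /\
  forall u n, N[A u - diag_sum f g n u] <= tail n * (C * N[u]).

Lemma diag_op_exists f g (Mf Mg : R) :
  (forall n, N[f n] <= Mf) -> (forall n, N[g n] <= Mg) ->
  exists A, is_diag_op f g (Mf * Mg) A.
Proof.
move=> fM gM.
have Mf0 : 0 <= Mf by apply: le_trans (fM 0%N); exact: L2norm_ge0.
have Mg0 : 0 <= Mg by apply: le_trans (gM 0%N); exact: L2norm_ge0.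
have H u : exists x, forall n, N[x - diag_sum f g n u] <= tail n * (Mf * Mg * N[u]).
  set K := Mf * Mg * N[u].
  have E : series (fun n => s n * K) = fun n => series s n * K.
    by apply/funext => n; rewrite /series/= mulr_suml.
  have c1 : series (fun n => s n * K) @ \oo --> limn (series s) * K.
    by rewrite E; apply: cvgM; [exact: s_summable | exact: cvg_cst].
  have [|x hx] := @L2_summable R (fun k => (s k)%:C *: rank_one (g k) (f k) u)
      (fun n => s n * K) _ (cvgP _ c1).
    move=> n; rewrite L2normZ normcR ger0_norm// ler_wpM2l// /K /rank_one L2normZ.
    apply: (@le_trans _ _ (N[u] * N[f n] * Mg)).
      by apply: ler_pM; rewrite ?normc_ge0 ?L2norm_ge0 ?L2_CauchySchwarz.
    rewrite [leRHS]mulrC [leRHS]mulrA ler_wpM2r//.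
    by rewrite ler_wpM2l ?L2norm_ge0.
  exists x => n; apply: (le_trans (hx n)).
  by rewrite (cvg_lim (@norm_hausdorff _ R) c1) E mulrBl.
have [A HA] := choice H.
by exists A; split; [exact: mulr_ge0 | exact: HA].
Qed.

Section Properties.
Variables (f g : nat -> L2 R) (C : R) (A : L2 R -> L2 R).
Hypothesis dA : is_diag_op f g C A.

Lemma diag_op_cvg u : L2cvg (fun n => diag_sum f g n u) (A u).
Proof.
have h : tail n * (C * N[u]) @[n --> \oo] --> (0 : R).
  rewrite -[X in _ --> X](mul0r (C * N[u])).
  by apply: cvgM; [exact: series_tail_cvg0 | exact: cvg_cst].
by apply: (L2cvg_squeeze h); have [_] := dA.
Qed.

Lemma diag_op_bounded : bounded_operator A.
Proof.
have [C0 hA] := dA; split.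
  move=> a u v; apply: (L2cvg_unique (diag_op_cvg (a *: u + v))).
  rewrite /L2cvg; under eq_fun do rewrite diag_sumZD.
  exact: L2cvgD (L2cvgZ a (diag_op_cvg u)) (diag_op_cvg v).
exists (limn (series s) * C) => u.
have := hA u 0%N; rewrite /diag_sum big_ord0 subr0 /series/= big_geq// subr0.
by rewrite mulrA.
Qed.

Lemma diag_op_series :
  operator_series (fun n u => (s n)%:C *: rank_one (g n) (f n) u) A.
Proof.
have [C0 hA] := dA => eps e0.
have h : tail n * C @[n --> \oo] --> (0 : R).
  rewrite -[X in _ --> X](mul0r C).
  by apply: cvgM; [exact: series_tail_cvg0 | exact: cvg_cst].
have /cvgrPdist_lt /(_ _ e0) := h; apply: filterS => n hn u.
apply: (le_trans (hA u n)); rewrite mulrA ler_wpM2r ?L2norm_ge0//.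
by move: hn; rewrite sub0r normrN => /ltW; apply: le_trans; exact: ler_norm.
Qed.

End Properties.

Section Positive.
Variables (g : nat -> L2 R) (C : R) (A : L2 R -> L2 R).
Hypothesis dA : is_diag_op g g C A.

Lemma diag_sum_self n u :
  << diag_sum g g n u, u >> = (\sum_(k < n) s k * Normc.normc << u, g k >> ^+ 2)%:C.
Proof.
rewrite diag_sum_inner raddf_sum/=; apply: eq_bigr => k _.
by rewrite -[<< g k, u >>]L2inner_conj mulc_conj -rmorphM.
Qed.

Lemma diag_op_symmetric u v : << A u, v >> = << u, A v >>.
Proof.
have E n : << diag_sum g g n u, v >> = << u, diag_sum g g n v >>.
  rewrite -[RHS]L2inner_conj !diag_sum_inner.
  elim/big_ind2 : _ => [|x1 x2 y1 y2 -> ->|k _]; first by rewrite /conjc/= oppr0.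
    by rewrite conjcD.
  rewrite !conjcM !L2inner_conj [X in _ = X * _](_ : _ = (s k)%:C).
    by rewrite [<< g k, v >> * _]mulrC.
  by rewrite /conjc/= oppr0.
have h1 := L2cvg_inner v (diag_op_cvg dA u).
have h2 := L2cvg_inner u (diag_op_cvg dA v).
have h : Normc.normc (<< A u, v >> - << diag_sum g g n u, v >>) +
    Normc.normc (<< A v, u >> - << diag_sum g g n v, u >>) @[n --> \oo] --> (0 : R).
  by rewrite -[X in _ --> X](addr0 0); exact: cvgD h1 h2.
apply/eqP; rewrite -subr_eq0; apply/eqP/Normc.eq0_normc/eqP.
rewrite eq_le normc_ge0 andbT; apply: (cvg0_le h) => n.
rewrite -[in X in _ <= _ + X]normc_conj.
have -> : conjc (<< A v, u >> - << diag_sum g g n v, u >>) =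
    << u, A v >> - << diag_sum g g n u, v >>.
  by rewrite E conjcB !L2inner_conj.
rewrite -[X in _ <= _ + X]normcN opprB.
apply: le_trans (ler_normcD _ _).
by rewrite addrA subrK.
Qed.

(** The partial sums of [<A u, u>] are real and non-negative, so the diagonal
    entries of [A] are series of non-negative terms. *)
Lemma diag_op_self u :
  (\sum_(0 <= k <oo) (s k * Normc.normc << u, g k >> ^+ 2)%:E =
   (Re << A u, u >>)%:E)%E /\ << A u, u >> = (Re << A u, u >>)%:C.
Proof.
have h1 := L2cvg_inner u (diag_op_cvg dA u).
pose q n := \sum_(k < n) s k * Normc.normc << u, g k >> ^+ 2.
have hR : q @ \oo --> Re << A u, u >>.
  apply/cvgrPdist_le => e e0; have /cvgrPdist_le /(_ _ e0) := h1.
  apply: filterS => n; rewrite sub0r normrN ger0_norm ?normc_ge0// diag_sum_self.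
  apply: le_trans; apply: le_trans (abs_Re_le _).
  by rewrite -/(q n); case: << A u, u >>.
have hI : complex.Im << A u, u >> = 0.
  apply/eqP; rewrite -normr_le0; apply: (cvg0_le h1) => n; rewrite diag_sum_self.
  apply: le_trans (abs_Im_le _).
  by rewrite -/(q n); case: << A u, u >> => x y /=; rewrite oppr0 addr0.
split; last by move: hI; case: << A u, u >> => x y /= ->.
apply/cvg_lim => //; under eq_fun do rewrite sumEFin big_mkord.
by apply: cvg_EFin; [exact: nearW | exact: hR].
Qed.

(** A non-negative symmetric operator satisfies [A^2 = A^* A], so it is its own
    absolute value and no square root has to be extracted. *)
Lemma diag_op_abs : operator_abs A A.
Proof.
split; first exact: diag_op_bounded dA.
  move=> u; have [E ->] := diag_op_self u.
  rewrite ler0c -lee_fin -E; apply: nneseries_ge0 => k _ _.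
  by rewrite lee_fin mulr_ge0 ?sqr_ge0.
by move=> u v; rewrite diag_op_symmetric.
Qed.

End Positive.

End DiagonalOperators.

Arguments Normc.normc : simpl never.
(** * Parseval's identity and traces *)

Section Parseval.
Variable R : realType.
Variable e : nat -> L2 R.
Implicit Types (u v : L2 R) (c : nat -> R[i]).
Local Notation "N[ u ]" := (L2norm u).
Local Notation "<< u , v >>" := (L2inner u v).
Local Notation Re := complex.Re.

(** Completing the square in each coefficient. *)
Lemma L2norm_sqrB_lincomb u c n : Defs.orthonormal e ->
  N[u - \sum_(i < n) c i *: e i] ^+ 2 = N[u] ^+ 2 +
  \sum_(i < n) (Normc.normc (c i - << u, e i >>) ^+ 2 - Normc.normc << u, e i >> ^+ 2).
Proof.
move=> oe; elim: n => [|n IH]; first by rewrite !big_ord0 subr0 addr0.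
rewrite !big_ord_recr/= opprD addrA L2norm_sqrB IH -!addrA; congr (_ + (_ + _)).
have -> : << u - \sum_(i < n) c i *: e i, c n *: e n >> = conjc (c n) * << u, e n >>.
  rewrite L2innerZr L2innerBl (L2inner_suml n (fun i => c i *: e i)) big1 ?subr0// => i _.
  by rewrite L2innerZl oe (ltn_eqF (ltn_ord i)) mulr0.
have en : N[e n] ^+ 2 = 1 by rewrite L2norm2 oe eqxx.
rewrite L2normZ exprMn en mulr1; move: (c n) << u, e n >> => p q.
by rewrite !normc2E; case: p q => a b [x y] /=; ring.
Qed.

Lemma bessel u n : Defs.orthonormal e ->
  \sum_(i < n) Normc.normc << u, e i >> ^+ 2 <= N[u] ^+ 2.
Proof.
move=> oe; have := L2norm_sqrB_lincomb u (fun i => << u, e i >>) n oe.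
under [X in _ = _ + X]eq_bigr do rewrite subrr normc0 expr0n/= sub0r.
rewrite sumrN => h; rewrite -subr_ge0 -h; exact: sqr_ge0.
Qed.

(** The orthogonal projection is the best approximation, so the density of the
    linear span makes Bessel's inequality an equality in the limit. *)
Lemma parseval u : orthonormal_basis e ->
  (\sum_(0 <= n <oo) (Normc.normc << u, e n >> ^+ 2)%:E = (N[u] ^+ 2)%:E)%E.
Proof.
move=> [oe de]; apply/cvg_lim => //; under eq_fun do rewrite sumEFin big_mkord.
apply: cvg_EFin; first exact: nearW.
pose a n := \sum_(i < n) Normc.normc << u, e i >> ^+ 2.
rewrite -[X in X @ _]/a.
have a_nd n m : (n <= m)%N -> a n <= a m.
  move=> nm; rewrite /a -!(big_mkord xpredT (fun i => Normc.normc << u, e i >> ^+ 2)).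
  by rewrite (big_cat_nat (leq0n n) nm)//= lerDl sumr_ge0// => i _; exact: sqr_ge0.
apply/cvgrPdist_le => eps e0.
have se0 : 0 < Num.sqrt eps by rewrite sqrtr_gt0.
have [n [c hc]] := de u _ se0.
have {}hc : N[u] ^+ 2 - a n <= eps.
  pose c' i := oapp c 0 (insub i).
  have E : \sum_(i < n) c i *: e i = \sum_(i < n) c' i *: e i.
    by apply: eq_bigr => i _; rewrite /c' valK.
  apply: (@le_trans _ _ (N[u - \sum_(i < n) c i *: e i] ^+ 2)).
    rewrite E L2norm_sqrB_lincomb// lerD2l -sumrN; apply: ler_sum => i _.
    by rewrite lerBrDl addrN sqr_ge0.
  rewrite -[leRHS]sqr_sqrtr ?(ltW e0)// ler_sqr ?nnegrE ?L2norm_ge0 ?sqrtr_ge0//.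
  exact: ltW.
exists n => // m /= nm; rewrite ger0_norm ?subr_ge0; last exact: bessel.
by apply: le_trans hc; rewrite lerB// a_nd.
Qed.

End Parseval.

Section Trace.
Variable R : realType.
Variables (s : nat -> R).
Hypothesis s_ge0 : forall n, 0 <= s n.
Hypothesis s_summable : cvgn (series s).
Variables (g : nat -> L2 R) (C : R) (A : L2 R -> L2 R) (t : R).
Hypothesis dA : is_diag_op s g g C A.
Hypothesis g_norm : forall k, L2norm (g k) ^+ 2 = t.
Local Notation "<< u , v >>" := (L2inner u v).
Local Notation Re := complex.Re.

(** Tonelli's theorem exchanges the sums over the basis and over the rank-one
    terms; Parseval's identity then evaluates each rank-one trace. *)
Lemma diag_op_sum_basis (e : nat -> L2 R) : orthonormal_basis e ->
  (\sum_(0 <= n <oo) (Re << A (e n), e n >>)%:E = (t * limn (series s))%:E)%E.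
Proof.
move=> be.
have t0 : 0 <= t by rewrite -(g_norm 0); exact: sqr_ge0.
transitivity (\sum_(0 <= n <oo) \sum_(0 <= k <oo)
    (s k * Normc.normc << e n, g k >> ^+ 2)%:E)%E.
  apply: eq_eseriesr => n _.
  by have [-> _] := diag_op_self s_summable dA (e n).
rewrite nneseries_interchange; last first.
  by move=> n k; rewrite lee_fin mulr_ge0 ?sqr_ge0.
transitivity (\sum_(0 <= k <oo) (t%:E * (s k)%:E))%E.
  apply: eq_eseriesr => k _.
  under eq_eseriesr do rewrite EFinM -normc_conj L2inner_conj.
  rewrite nneseriesZl; last by move=> n _; rewrite lee_fin sqr_ge0.
  by rewrite parseval// g_norm -!EFinM mulrC.
rewrite nneseriesZl; last by move=> k _; rewrite lee_fin.
by rewrite nneseries_limn.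
Qed.

Lemma diag_op_trace_class : trace_class A.
Proof.
split; first exact: diag_op_bounded dA.
exists A; first exact: (diag_op_abs s_ge0 s_summable dA).
by move=> e be; rewrite diag_op_sum_basis// ltry.
Qed.

Lemma diag_op_has_trace : has_trace A (t * limn (series s))%:C.
Proof.
move=> e be.
pose x n := Re << A (e n), e n >>.
have Ex n : << A (e n), e n >> = (x n)%:C.
  by have [_ ->] := diag_op_self s_summable dA (e n).
have E := diag_op_sum_basis be.
have x0 n : 0 <= x n.
  have [_ /(_ (e n)) + _] := diag_op_abs s_ge0 s_summable dA.
  by rewrite Ex ler0c.
have cx : cvgn (series x) by apply: nneseries_cvgn => //; rewrite E ltry.
have Lx : limn (series x) = t * limn (series s).
  by apply: EFin_inj; rewrite -E nneseries_limn.
have {}cx : series x @ \oo --> t * limn (series s) by rewrite -Lx.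
apply/cvgrPdist_lt => eps; rewrite ltcE/= => /andP[/eqP i0 e0].
have /cvgrPdist_lt /(_ _ e0) := cx; apply: filterS => n.
have -> : series (fun n => << A (e n), e n >>) n = (series x n)%:C.
  by rewrite /series/= raddf_sum/=; apply: eq_bigr => k _; rewrite Ex.
move=> h; rewrite -rmorphB/= normc_def/= expr0n/= addr0 sqrtr_sqr ltcE/=.
by rewrite h andbT i0.
Qed.

End Trace.

(** * The unbounded operator D^-1 *)

Section Multipliers.
Variable R : realType.
Implicit Types (u v x y : L2 R) (f h : R -> R[i]) (w : R -> R) (r : R).
Local Notation mu := (@lebesgue_measure R).
Local Notation "N[ u ]" := (L2norm u).
Local Notation "<< u , v >>" := (L2inner u v).
Local Notation Re := complex.Re.
Local Notation Im := complex.Im.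

(** A subset of a null set need not be Borel, so measurability does not pass from [h] to [f]. *)
Lemma isL2_aeq f h : measurable_fun Rplus (fun r => Re (f r)) ->
  measurable_fun Rplus (fun r => Im (f r)) -> isL2 h -> aeq h f -> isL2 f.
Proof.
move=> f1 f2 [h1 h2 Ih] hf; split=> //.
rewrite -(@ge0_ae_eq_integral _ _ _ mu _ (fun r => (Normc.normc (h r) ^+ 2 / r)%:E))//.
- exact: measurable_Rplus.
- by apply/measurable_EFinP; exact: measurable_normc2.
- by apply/measurable_EFinP; exact: measurable_normc2.
- by move=> r; rewrite RplusE lee_fin => r0; exact: normc2_ge0.
- by move=> r; rewrite RplusE lee_fin => r0; exact: normc2_ge0.
- by apply: ae_imply hf => r H rR; rewrite H.
Qed.

Lemma normc2_mulr (c : R) (z : R[i]) :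
  Normc.normc (c%:C * z) ^+ 2 = c ^+ 2 * Normc.normc z ^+ 2.
Proof. by rewrite !normc2E; case: z => a b /=; ring. Qed.

Lemma measurable_mul w u : measurable_fun Rplus w ->
  measurable_fun Rplus (fun r => Re ((w r)%:C * L2repr u r)) /\
  measurable_fun Rplus (fun r => Im ((w r)%:C * L2repr u r)).
Proof.
move=> mw; have [u1 u2 _] := isL2_repr u; split.
  have E r : Re ((w r)%:C * L2repr u r) = w r * Re (L2repr u r).
    by rewrite Re_mulc /= mul0r subr0.
  by under eq_fun do rewrite E; exact: measurable_funM.
have E r : Im ((w r)%:C * L2repr u r) = w r * Im (L2repr u r).
  by rewrite Im_mulc /= mul0r addr0.
by under eq_fun do rewrite E; exact: measurable_funM.
Qed.

Lemma mul_op_bounded w (C : R) u : measurable_fun Rplus w -> 0 <= C ->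
  (forall r, 0 < r -> `|w r| <= C) ->
  aeq (L2repr (mul_op w u)) (fun r => (w r)%:C * L2repr u r) /\
  N[mul_op w u] <= C * N[u].
Proof.
move=> mw C0 wC; have mR := @measurable_Rplus R.
have [m1 m2] := measurable_mul u mw.
have /isL2P[u1 u2 Iu] := isL2_repr u.
have le : (\int[mu]_(r in Rplus) (Normc.normc ((w r)%:C * L2repr u r) ^+ 2 / r)%:E <=
    ((C * N[u]) ^+ 2)%:E)%E.
  rewrite exprMn EFinM (@L2norm2_aeq _ u (L2repr u)); [|exact: isL2_repr|exact: ae_eq_refl].
  rewrite -ge0_integralZl_EFin ?sqr_ge0//; last 2 first.
  - by move=> r; rewrite RplusE lee_fin => r0; exact: normc2_ge0.
  - by case/integrableP : Iu.
  apply: ge0_le_integral => //.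
  - by move=> r; rewrite RplusE lee_fin => r0; apply: (normc2_ge0 (fun r => (w r)%:C * L2repr u r)).
  - by apply/measurable_EFinP; exact: measurable_normc2.
  - by apply: measurable_funeM; case/integrableP : Iu.
  move=> r; rewrite RplusE => r0; rewrite -EFinM lee_fin normc2_mulr -mulrA.
  apply: ler_wpM2r; first exact: normc2_ge0.
  by rewrite -[w r ^+ 2]real_normK ?num_real// ler_sqr ?nnegrE// wC.
have w2 : isL2 (fun r => (w r)%:C * L2repr u r).
  by split => //; apply: le_lt_trans le _; rewrite ltry.
have E : aeq (L2repr (mul_op w u)) (fun r => (w r)%:C * L2repr u r).
  exact: L2repr_toL2.
split=> //.
rewrite -(@ler_sqr _ _ _) ?nnegrE ?L2norm_ge0 ?mulr_ge0 ?L2norm_ge0//.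
by rewrite -lee_fin (L2norm2_aeq w2 E).
Qed.

(** The graph of [opDinv], as a relation up to null sets: it handles membership
    in the domain and the value of the operator together. *)
Definition Dinv_graph u v : Prop :=
  aeq (L2repr v) (fun r => (r `^ (- 2^-1))%:C * L2repr u r).

Lemma Dinv_graph_opDinv u : domDinv u -> Dinv_graph u (opDinv u).
Proof. exact: L2repr_toL2. Qed.

Lemma Dinv_graphP u v : Dinv_graph u v -> domDinv u /\ opDinv u = v.
Proof.
move=> uv; have du : domDinv u.
  have mp : measurable_fun Rplus (fun r : R => r `^ (- 2^-1)).
    by apply: measurable_funTS; exact: measurable_powR.
  have [m1 m2] := measurable_mul u mp.
  exact: isL2_aeq m1 m2 (isL2_repr v) uv.
split=> //; apply: L2_eq; apply: aeq_trans (aeq_sym uv).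
exact: Dinv_graph_opDinv.
Qed.

Lemma Dinv_graph0 : Dinv_graph 0 0.
Proof.
apply: ae_imply (L2repr0 R) => r h r0.
by rewrite h// mulr0.
Qed.

Lemma Dinv_graphD u v x y : Dinv_graph u v -> Dinv_graph x y -> Dinv_graph (u + x) (v + y).
Proof.
move=> uv xy.
have h : {ae mu, forall r, Rplus r -> L2repr v r + L2repr y r =
    (r `^ (- 2^-1))%:C * (L2repr u r + L2repr x r)}.
  by apply: ae_imply2 uv xy => r h1 h2 r0; rewrite h1// h2// mulrDr.
have h' := ae_and (L2reprD u x) (L2reprD v y).
by apply: ae_imply2 h h' => r h1 [h2 h3] r0; rewrite h2// h3// h1.
Qed.

Lemma Dinv_graphZ (a : R[i]) u v : Dinv_graph u v -> Dinv_graph (a *: u) (a *: v).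
Proof.
move=> uv.
have h' := ae_and (L2reprZ a u) (L2reprZ a v).
by apply: ae_imply2 uv h' => r h1 [h2 h3] r0; rewrite h2// h3// h1// mulrCA.
Qed.

Lemma conjcR (c : R) : conjc c%:C = c%:C.
Proof. by rewrite /conjc/= oppr0. Qed.

(** Symmetry of [opDinv]; the two integrands agree almost everywhere. *)
Lemma Dinv_graph_inner u u' v v' : Dinv_graph u u' -> Dinv_graph v v' ->
  << u', v >> = << u, v' >>.
Proof.
move=> uu' vv'; rewrite !L2innerE; apply: wint_aeq; try exact: wintegrable_inner.
by apply: ae_imply2 uu' vv' => r h1 h2 r0; rewrite h1// h2// conjcM conjcR mulrCA mulrA.
Qed.

(** With [q] the square root of the variable, the multiplier [k q / (1 + k q)]
    stays in [0, 1] and increases to 1 with [k]; its quotient by [q], which is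
    [cutoffDinv k], is bounded by [k], so that multiplication by [cutoff k] maps
    into the domain of [opDinv]. *)
Definition cutoff (k : R) r : R := k * r `^ 2^-1 / (1 + k * r `^ 2^-1).
Definition cutoffDinv (k : R) r : R := k / (1 + k * r `^ 2^-1).

Lemma cutoff_denom_gt0 (k r : R) : 0 <= k -> 0 < 1 + k * r `^ 2^-1.
Proof. by move=> k0; rewrite ltr_wpDr// mulr_ge0// powR_ge0. Qed.

Lemma measurable_sqrt_powR : measurable_fun Rplus (fun r : R => r `^ 2^-1).
Proof. by apply: measurable_funTS; exact: measurable_powR. Qed.

Lemma measurable_cutoffDinv (k : R) : 0 <= k -> measurable_fun Rplus (cutoffDinv k).
Proof.
move=> k0; apply: measurable_funTS; apply: measurable_funM; first exact: measurable_cst.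
under eq_fun do rewrite -powR_inv1 ?(ltW (cutoff_denom_gt0 _ k0))//.
apply: (measurableT_comp (measurable_powR (-1))).
by apply: measurable_funD => //; exact: measurable_funM.
Qed.

Lemma measurable_cutoff (k : R) : 0 <= k -> measurable_fun Rplus (cutoff k).
Proof.
move=> k0.
have -> : cutoff k = fun r => r `^ 2^-1 * cutoffDinv k r.
  by apply/funext => r; rewrite /cutoff /cutoffDinv [k * _]mulrC mulrA.
apply: measurable_funM; first exact: measurable_sqrt_powR.
exact: measurable_cutoffDinv.
Qed.

Lemma cutoff_bound (k r : R) : 0 <= k -> 0 < r -> `|cutoff k r| <= 1.
Proof.
move=> k0 r0; have d0 := cutoff_denom_gt0 r k0.
have n0 : 0 <= k * r `^ 2^-1 by rewrite mulr_ge0// powR_ge0.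
rewrite ger0_norm /cutoff ?divr_ge0 ?(ltW d0)//.
by rewrite ler_pdivrMr// mul1r lerDr.
Qed.

Lemma cutoffDinv_bound (k r : R) : 0 <= k -> 0 < r -> `|cutoffDinv k r| <= k.
Proof.
move=> k0 r0; have d0 := cutoff_denom_gt0 r k0.
rewrite ger0_norm /cutoffDinv ?divr_ge0 ?(ltW d0)//.
by rewrite ler_pdivrMr// ler_peMr// lerDl mulr_ge0// powR_ge0.
Qed.

Lemma cutoffDinvE (k r : R) : 0 < r -> cutoffDinv k r = r `^ (- 2^-1) * cutoff k r.
Proof.
move=> r0; have q0 : r `^ 2^-1 != 0 by rewrite gt_eqF// powR_gt0.
by rewrite /cutoff /cutoffDinv powRN [RHS]mulrA [_ ^-1 * (k * _)]mulrCA mulVf// mulr1.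
Qed.

Lemma cutoff_graph (k : R) u : 0 <= k ->
  Dinv_graph (mul_op (cutoff k) u) (mul_op (cutoffDinv k) u).
Proof.
move=> k0.
have [h1 _] := mul_op_bounded u (measurable_cutoff k0) ler01 (fun r => cutoff_bound k0).
have [h2 _] := mul_op_bounded u (measurable_cutoffDinv k0) k0 (fun r => cutoffDinv_bound k0).
apply: ae_imply2 h1 h2 => r h1 h2 rR; rewrite h1// h2// mulrA -rmorphM/=.
by rewrite cutoffDinvE// -RplusE.
Qed.

Lemma mul_opB w (C : R) u v : measurable_fun Rplus w -> 0 <= C ->
  (forall r, 0 < r -> `|w r| <= C) -> mul_op w (u - v) = mul_op w u - mul_op w v.
Proof.
move=> mw C0 wC; apply: L2_eq.
have [h1 _] := mul_op_bounded u mw C0 wC.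
have [h2 _] := mul_op_bounded v mw C0 wC.
have [h3 _] := mul_op_bounded (u - v) mw C0 wC.
have h4 := L2reprB u v; have h5 := L2reprB (mul_op w u) (mul_op w v).
have a1 := ae_and h1 h2.
have a2 := ae_and h3 h4.
have a3 := ae_and a1 a2.
apply: ae_imply2 a3 h5 => r [[e1 e2] [e3 e4]] e5 r0.
by rewrite e3// e4// e5// e1// e2// mulrBr.
Qed.

(** [opDinv] is a closed operator: multiplying by a cutoff turns both sides of
    the graph relation into bounded, hence continuous, operators. *)
Lemma Dinv_graph_closed (P Q : nat -> L2 R) x y :
  (forall n, Dinv_graph (P n) (Q n)) -> L2cvg P x -> L2cvg Q y -> Dinv_graph x y.
Proof.
move=> PQ Px Qy.
have m1 := measurable_cutoff ler01; have m2 := measurable_cutoffDinv ler01.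
have b1 r : 0 < r -> `|cutoff 1 r| <= 1 :> R := @cutoff_bound 1 r ler01.
have b2 r : 0 < r -> `|cutoffDinv 1 r| <= 1 :> R := @cutoffDinv_bound 1 r ler01.
have E n : mul_op (cutoff 1) (Q n) = mul_op (cutoffDinv 1) (P n).
  apply: L2_eq.
  have [h1 _] := mul_op_bounded (Q n) m1 ler01 b1.
  have [h2 _] := mul_op_bounded (P n) m2 ler01 b2.
  have h := ae_and h1 h2.
  apply: ae_imply2 h (PQ n) => r [e1 e2] e3 rR.
  rewrite e1// e2// e3// mulrA -rmorphM/= cutoffDinvE; last by rewrite -RplusE.
  by rewrite [cutoff 1 r * _]mulrC.
have Exy : mul_op (cutoff 1) y = mul_op (cutoffDinv 1) x.
  apply: (@L2cvg_unique _ (fun n => mul_op (cutoff 1) (Q n))).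
    apply: L2cvg_squeeze Qy _ => n; rewrite -(mul_opB _ _ m1 ler01 b1).
    have [_] := mul_op_bounded (y - Q n) m1 ler01 b1; by rewrite mul1r.
  rewrite (_ : (fun n => _) = fun n => mul_op (cutoffDinv 1) (P n)); last exact/funext.
  apply: L2cvg_squeeze Px _ => n; rewrite -(mul_opB _ _ m2 ler01 b2).
  have [_] := mul_op_bounded (x - P n) m2 ler01 b2; by rewrite mul1r.
have [h1 _] := mul_op_bounded y m1 ler01 b1.
have [h2 _] := mul_op_bounded x m2 ler01 b2.
apply: ae_imply2 h1 h2 => r; rewrite Exy => e1 e2 rR.
have := e1 rR; rewrite e2//; rewrite RplusE in rR.
rewrite cutoffDinvE// rmorphM/= [X in X * _]mulrC -mulrA => /mulfI -> //.
have c0 : 0 < cutoff 1 r.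
  by rewrite /cutoff divr_gt0 ?cutoff_denom_gt0// mul1r powR_gt0.
by rewrite -[0]/(0%:C) (inj_eq (@complexI R)) gt_eqF.
Qed.

(** Density of the domain of [opDinv], by dominated convergence. *)
Lemma cutoff_cvg u : L2cvg (fun n => mul_op (cutoff n%:R) u) u.
Proof.
have mR := @measurable_Rplus R.
have /isL2P[u1 u2 Iu] := isL2_repr u.
pose d (n : nat) r : R := (1 + n%:R * r `^ 2^-1)^-1.
have dE n r : 1 - cutoff n%:R r = d n r.
  have h := cutoff_denom_gt0 r (ler0n R n).
  by rewrite /cutoff /d -[X in X - _](@divff _ (1 + n%:R * r `^ 2^-1)) ?gt_eqF// -mulrBl addrK mul1r.
have md n : measurable_fun Rplus (d n).
  rewrite -(funext (dE n)).
  by apply: measurable_funB => //; exact: measurable_cutoff.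
pose f n r := Normc.normc ((d n r)%:C * L2repr u r) ^+ 2 / r.
have mf n : measurable_fun Rplus (EFin \o f n).
  have [m1 m2] := measurable_mul u (md n).
  by apply/measurable_EFinP; exact: measurable_normc2.
have d01 n r : 0 <= d n r <= 1.
  have h := cutoff_denom_gt0 r (ler0n R n).
  rewrite invr_ge0 ltW//= invf_le1// lerDl mulr_ge0// powR_ge0//.
have f0 n r : 0 < r -> 0 <= f n r <= Normc.normc (L2repr u r) ^+ 2 / r.
  move=> r0; rewrite (normc2_ge0 (fun r => (d n r)%:C * L2repr u r))//=.
  rewrite /f normc2_mulr -mulrA ler_piMl ?normc2_ge0//.
  have /andP[d0 d1] := d01 n r; exact: exprn_ile1.
have fcvg r : 0 < r -> f n r @[n --> \oo] --> (0 : R).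
  move=> r0; have q0 : 0 < r `^ 2^-1 by rewrite powR_gt0.
  have dc : d n r @[n --> \oo] --> (0 : R).
    have h : n.+1%:R^-1 * (r `^ 2^-1)^-1 @[n --> \oo] --> (0 : R).
      rewrite -[X in _ --> X](mul0r (r `^ 2^-1)^-1).
      by apply: cvgM; [exact: cvg_harmonic | exact: cvg_cst].
    rewrite -(cvg_shiftS (fun n => d n r)).
    apply: (squeeze_cvgr _ (cvg_cst 0) h); apply: nearW => n.
    have /andP[-> _] /= := d01 n.+1 r.
    rewrite -invfM lef_pV2 ?posrE ?mulr_gt0 ?cutoff_denom_gt0//.
    by rewrite lerDr.
  have -> : (fun n => f n r) =
      fun n => d n r * d n r * (Normc.normc (L2repr u r) ^+ 2 / r).
    by apply/funext => n; rewrite /f normc2_mulr -[LHS]mulrA [d n r ^+ 2]expr2.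
  have dd := cvgM dc dc; rewrite mulr0 in dd.
  rewrite -[X in _ --> X](mul0r (Normc.normc (L2repr u r) ^+ 2 / r)).
  by apply: cvgM; [exact: dd | exact: cvg_cst].
have N2 n : (N[u - mul_op (cutoff n%:R) u] ^+ 2)%:E = (\int[mu]_(r in Rplus) (f n r)%:E)%E.
  have [h1 _] := mul_op_bounded u (measurable_cutoff (ler0n R n)) ler01
    (fun r => cutoff_bound (ler0n R n)).
  have h : aeq (L2repr (u - mul_op (cutoff n%:R) u)) (fun r => (d n r)%:C * L2repr u r).
    apply: ae_imply2 h1 (L2reprB u (mul_op (cutoff n%:R) u)) => r e1 e2 rR.
    by rewrite e2// e1// -dE rmorphB/= mulrBl mul1r.
  have [m1 m2] := measurable_mul u (md n).
  exact: L2norm2_aeq (isL2_aeq m1 m2 (isL2_repr _) h) h.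
have H1 : {ae mu, forall r, Rplus r -> (f n r)%:E @[n --> \oo] --> (0%:E : \bar R)}.
  by apply: aeW => r; rewrite RplusE => r0; apply: cvg_EFin; [exact: nearW | exact: fcvg].
have H2 : {ae mu, forall r n, Rplus r ->
    (`|(f n r)%:E| <= (Normc.normc (L2repr u r) ^+ 2 / r)%:E)%E}.
  apply: aeW => r n; rewrite RplusE => r0 /=; have /andP[f1 f2] := f0 n r r0.
  by rewrite ger0_norm.
have [_ _ I0] := @dominated_convergence _ _ R mu Rplus mR
  (fun n => EFin \o f n) (cst 0%E)
  (EFin \o (fun r => Normc.normc (L2repr u r) ^+ 2 / r)) mf (measurable_cst _) H1 Iu H2.
have {}I0 : N[u - mul_op (cutoff n%:R) u] ^+ 2 @[n --> \oo] --> (0 : R).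
  apply: (@fine_cvg _ _ _ _ (fun n => (N[u - mul_op (cutoff n%:R) u] ^+ 2)%:E)).
  by under eq_fun do rewrite N2; move: I0; rewrite integral0.
apply/cvgrPdist_le => eps e0.
have /cvgrPdist_le /(_ _ (exprn_gt0 2 e0)) := I0; apply: filterS => n.
rewrite !sub0r !normrN !ger0_norm ?sqr_ge0 ?L2norm_ge0//.
by rewrite ler_sqr ?nnegrE ?L2norm_ge0 ?(ltW e0).
Qed.

End Multipliers.

(** * The operator D^-1 S D^-1 *)

Section Sandwich.
Variable R : realType.
Variables (s : nat -> R).
Hypothesis s_summable : cvgn (series s).
Implicit Types (f L g : nat -> L2 R) (u v : L2 R) (A B T : L2 R -> L2 R).
Local Notation "N[ u ]" := (L2norm u).

Lemma Dinv_graph_diag_sum f L g n u : (forall k, Dinv_graph (L k) (g k)) ->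
  Dinv_graph (diag_sum s f L n u) (diag_sum s f g n u).
Proof.
move=> Lg; rewrite /diag_sum; elim: n => [|n IH].
  by rewrite !big_ord0; exact: Dinv_graph0.
rewrite !big_ord_recr/=; apply: Dinv_graphD => //.
by apply: Dinv_graphZ; apply: Dinv_graphZ; exact: Lg.
Qed.

(** The partial sums lie in the graph, which is closed.  As the coefficients
    [<u, f k>] are bounded functionals, [A] maps the whole space into the domain
    of [opDinv]. *)
Lemma Dinv_graph_diag_op f L g (C D : R) A B u :
  (forall k, Dinv_graph (L k) (g k)) ->
  is_diag_op s f L C A -> is_diag_op s f g D B -> Dinv_graph (A u) (B u).
Proof.
move=> Lg dA dB.
apply: (@Dinv_graph_closed _ (fun n => diag_sum s f L n u) (fun n => diag_sum s f g n u)).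
- by move=> n; exact: Dinv_graph_diag_sum.
- exact: diag_op_cvg dA u.
- exact: diag_op_cvg dB u.
Qed.

(** By symmetry of [opDinv] the two series have the same coefficients,
    [<u', L k> = <u, g k>]. *)
Lemma diag_op_Dinv L g f (C D : R) A B u u' :
  (forall k, Dinv_graph (L k) (g k)) -> Dinv_graph u u' ->
  is_diag_op s L f C A -> is_diag_op s g f D B -> A u' = B u.
Proof.
move=> Lg uu' dA dB; apply: (L2cvg_unique (diag_op_cvg s_summable dA u')).
have E n : diag_sum s L f n u' = diag_sum s g f n u.
  by apply: eq_bigr => k _; rewrite /rank_one (Dinv_graph_inner uu' (Lg k)).
rewrite /L2cvg; under eq_fun do rewrite E.
exact: (diag_op_cvg s_summable dB u).
Qed.

Lemma bounded_operatorB T u v : bounded_operator T -> T (u - v) = T u - T v.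
Proof. by move=> [lT _]; rewrite addrC -scaleN1r lT scaleN1r addrC. Qed.

(** Bounded operators are determined by their values on the dense domain of
    [opDinv], so the bounded extension in the definition of admissibility is
    unique. *)
Lemma bounded_operator_ext T A : bounded_operator T -> bounded_operator A ->
  (forall u, domDinv u -> T u = A u) -> T = A.
Proof.
move=> bT bA TA; apply/funext => u.
have cvg_op B : bounded_operator B -> L2cvg (fun n => B (mul_op (cutoff n%:R) u)) (B u).
  move=> bB; have [_ [C hC]] := bB.
  have h : C * N[u - mul_op (cutoff n%:R) u] @[n --> \oo] --> (0 : R).
    rewrite -[X in _ --> X](mulr0 C).
    by apply: cvgM; [exact: cvg_cst | exact: cutoff_cvg].
  by apply: (L2cvg_squeeze h) => n; rewrite -bounded_operatorB.
apply: (L2cvg_unique (cvg_op _ bT)).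
rewrite (_ : (fun n => _) = fun n => A (mul_op (cutoff n%:R) u)); first exact: cvg_op.
apply/funext => n; apply: TA.
by have [] := Dinv_graphP (cutoff_graph u (ler0n R n)).
Qed.

End Sandwich.

(** * Norms of the Laguerre functions *)

Section LaguerreBasis.
Variable R : realType.
Variable alpha : R.
Hypothesis alpha_gt0 : 0 < alpha.
Local Notation mu := (@lebesgue_measure R).
Local Notation "N[ u ]" := (L2norm u).

Lemma real_L2norm2 (h : R -> R) : measurable_fun setT h ->
  mu.-integrable Rplus (EFin \o (fun r => h r ^+ 2 / r)) ->
  isL2 (fun r => (h r)%:C) /\ forall u, aeq (L2repr u) (fun r => (h r)%:C) ->
  N[u] ^+ 2 = \int[mu]_(r in Rplus) (h r ^+ 2 / r).
Proof.
move=> mh Ih.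
have E : (fun r => Normc.normc (h r)%:C ^+ 2 / r) = fun r => h r ^+ 2 / r.
  by apply/funext => r; rewrite normcR real_normK// num_real.
have h2 : isL2 (fun r => (h r)%:C).
  apply/isL2P; split; [exact: measurable_funTS | exact: measurable_cst |].
  by rewrite E.
split=> // u hu; apply: EFin_inj; rewrite (L2norm2_aeq h2 hu).
rewrite /Rintegral fineK; last by apply: integrable_fin_num => //; exact: measurable_Rplus.
by rewrite (funext (fun r => congr1 EFin (congr1 (fun F => F r) E))).
Qed.

Lemma laguerre_repr n :
  aeq (L2repr (laguerre alpha n)) (fun r => (laguerre_fun alpha n r)%:C).
Proof.
apply: L2repr_toL2.
have [Ih _] := integral_laguerre_fun_sqr n alpha_gt0.
by have [] := real_L2norm2 (measurable_laguerre_fun alpha n) Ih.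
Qed.

Lemma L2norm_laguerre n : N[laguerre alpha n] = 1.
Proof.
have [Ih E] := integral_laguerre_fun_sqr n alpha_gt0.
have [_ H] := real_L2norm2 (measurable_laguerre_fun alpha n) Ih.
by apply/eqP; rewrite -(@eqrXn2 _ 2)// ?L2norm_ge0// expr1n (H _ (laguerre_repr n)) E.
Qed.

Lemma laguerre_Dinv n : Dinv_graph (laguerre alpha n) (opDinv (laguerre alpha n)) /\
  N[opDinv (laguerre alpha n)] ^+ 2 = alpha^-1.
Proof.
pose h r := r `^ (- 2^-1) * laguerre_fun alpha n r.
have mh : measurable_fun setT h.
  by apply: measurable_funM; [exact: measurable_powR | exact: measurable_laguerre_fun].
have [Ih E] := integral_Dinv_laguerre_fun_sqr n alpha_gt0.
have [h2 H] := real_L2norm2 mh Ih.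
have H' : aeq (L2repr (toL2 (fun r => (h r)%:C))) (fun r => (h r)%:C) by exact: L2repr_toL2.
have G : Dinv_graph (laguerre alpha n) (toL2 (fun r => (h r)%:C)).
  apply: ae_imply2 H' (laguerre_repr n) => r e1 e2 r0.
  by rewrite e1// e2// -rmorphM.
have [_ ->] := Dinv_graphP G.
by split=> //; rewrite (H _ H') E.
Qed.

End LaguerreBasis.

Theorem corollary4p12 (R : realType) (s : nat -> R) (alpha : R)
    (s_ge0 : forall n, 0 <= s n)
    (s_summable : cvgn (series s))
    (s_neq0 : exists n, s n != 0)
    (alpha_gt0 : 0 < alpha) :
  exists S : L2 R -> L2 R,
    [/\ operator_series
          (fun n u => (s n)%:C *: rank_one (laguerre alpha n) (laguerre alpha n) u) S,
        admissible S &
        forall T : L2 R -> L2 R, trace_class T -> extends_DSD S T ->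
          has_trace T (alpha^-1 * limn (series s))%:C].
Proof.
pose L n := laguerre alpha n; pose g n := opDinv (L n).
have Lg n : Dinv_graph (L n) (g n) by have [] := laguerre_Dinv alpha_gt0 n.
have g2 n : L2norm (g n) ^+ 2 = alpha^-1 by have [] := laguerre_Dinv alpha_gt0 n.
have L1 n : L2norm (L n) <= 1 by rewrite L2norm_laguerre.
have gM n : L2norm (g n) <= Num.sqrt alpha^-1.
  by rewrite -(g2 n) sqrtr_sqr ger0_norm ?L2norm_ge0.
have [S dS] := diag_op_exists s_ge0 s_summable L1 L1.
have [B dB] := diag_op_exists s_ge0 s_summable L1 gM.
have [T dT] := diag_op_exists s_ge0 s_summable gM gM.
have bT := diag_op_bounded s_summable dT.
have S_dom u : domDinv (S u) /\ opDinv (S u) = B u.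
  exact: Dinv_graphP (Dinv_graph_diag_op s_summable u Lg dS dB).
have DSD u : domDinv u -> T u = opDinv (S (opDinv u)).
  move=> /Dinv_graph_opDinv uu'; have [_ ->] := S_dom (opDinv u).
  by rewrite (diag_op_Dinv s_summable Lg uu' dB dT).
exists S; split; first exact: diag_op_series dS.
(* The operator is non-zero: [<S L_n, L_n> >= s_n] as [||L_n|| = 1]. *)
- split; first exact: diag_op_bounded dS.
  + have [n sn] := s_neq0; exists (L n); apply: contra_neq sn => Sn.
    have [E _] := diag_op_self s_summable dS (L n).
    have t0 k : (0 <= (s k * Normc.normc (L2inner (L n) (L k)) ^+ 2)%:E)%E.
      by rewrite lee_fin mulr_ge0 ?sqr_ge0.
    have := nneseries_lim_ge n.+1 (fun k (_ : (0 <= k)%N) (_ : xpredT k) => t0 k).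
    rewrite E Sn L2inner0l big_nat_recr//= sumEFin -EFinD lee_fin.
    rewrite L2inner_self L2norm_laguerre// expr1n Normc.normc1 expr1n mulr1 => h.
    apply/eqP; rewrite eq_le s_ge0 andbT; apply: le_trans h.
    by rewrite lerDr sumr_ge0// => k _; rewrite mulr_ge0 ?sqr_ge0.
  + by move=> u _; have [] := S_dom u.
  + by have [_ [C hC]] := bT; exists C => u du; rewrite -DSD.
  + by exists T => //; exact: (diag_op_trace_class s_ge0 s_summable dT g2).
move=> T' [bT' _] T'S.
have -> : T' = T by apply: bounded_operator_ext => // u du; rewrite T'S// DSD.
exact: (diag_op_has_trace s_ge0 s_summable dT g2).
Qed.
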